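(* Let $V,G$ be smooth, $2\pi$-periodic real functions on $\mathbb{R}$ with $V$ even, $G$ odd and $G\not\equiv0$. Let $E_0$ be the lowest band edge (bottom of the spectrum) of $L=-\partial_x^2+V(x)$, with $2\pi$-periodic eigenfunction $\Psi_0$ normalized in $L^2(0,2\pi)$. Let $\Psi_1$ and $\Psi_2$ be the unique odd $2\pi$-periodic solutions, orthogonal to $\Psi_0$ in $L^2(0,2\pi)$, of $$-\Psi_1''+V\Psi_1-E_0\Psi_1=2\Psi_0',\qquad -\Psi_2''+V\Psi_2-E_0\Psi_2=-G\Psi_0^3.$$ Then the coefficients $$\alpha=-1-2\int_0^{2\pi}\Psi_1'(x)\Psi_0(x)\,dx,\qquad \chi=3\int_0^{2\pi}G(x)\Psi_0^3(x)\Psi_2(x)\,dx,$$ $$\gamma=-2\int_0^{2\pi}\Psi_2'(x)\Psi_0(x)\,dx+\int_0^{2\pi}G(x)\Psi_0^3(x)\Psi_1(x)\,dx$$ of the continuous nonlinear Schrödinger equation $$iA_T=\alpha A_{XX}+\chi|A|^4A+\gamma\left(|A|^2A\right)_X$$ satisfy $\gamma=0$, $\alpha<0$ and $\chi<0$, so that this equation is the focusing quintic equation $iA_T=\alpha A_{XX}+\chi|A|^4A$.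
   Context: The continuous equation is the amplitude equation obtained at leading order from the Gross–Pitaevskii equation $i\partial_t\Psi=-\partial_x^2\Psi+V(x)\Psi+G(x)|\Psi|^2\Psi$ with the ansatz $\Psi=\varepsilon^{1/2}\left(A\Psi_0+\varepsilon(A_X\Psi_1+|A|^2A\Psi_2)+\varepsilon^2\tilde\Psi\right)e^{-iE_0t}$, $A=A(X,T)$, $X=\varepsilon x$, $T=\varepsilon^2t$, with $\varepsilon$ a small parameter. All functions $\Psi_0,\Psi_1,\Psi_2$ are real-valued. *)

(* Defs.v *)
From mathcomp Require Import all_boot all_order all_algebra.
From mathcomp Require Import complex.
From mathcomp Require Import all_classical all_reals all_analysis.

Set Implicit Arguments.
Unset Strict Implicit.
Unset Printing Implicit Defensive.

Import Order.TTheory GRing.Theory Num.Theory.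
Import numFieldNormedType.Exports.

Local Open Scope classical_set_scope.
Local Open Scope ring_scope.
Local Open Scope complex_scope.

Section Definitions.
Context {R : realType}.
Local Notation mu := (@lebesgue_measure R).

Definition smooth (f : R -> R) : Prop :=
  forall n x, derivable (derive1n n f) x 1.

Definition intper (f : R -> R) : R := \int[mu]_(x in `[0, 2 * pi]) f x.

(* The self-adjoint realization of - d^2/dx^2 + V in L^2(R; C), with domain  *)
(* H^2(R).  The library integrates real functions only, so L^2 membership    *)
(* and differentiation are taken on real and imaginary parts.                *)

Definition inL2 (f : R -> R[i]) : Prop :=
  (@complex.Re R \o f) \in Lfun mu 2%:E /\
  (@complex.Im R \o f) \in Lfun mu 2%:E.

Definition normL2 (f : R -> R[i]) : \bar R :=
  Lnorm mu 2%:E (fun x => (complex.Re `|f x|)%:E).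

(* u is C^1, u' is locally absolutely continuous and u'' = g a.e.            *)
Definition AC_deriv2 (u g : R -> R) : Prop :=
  (forall x, derivable u x 1) /\
  forall a b : R, a <= b ->
    mu.-integrable `[a, b] (EFin \o g) /\
    derive1 u b - derive1 u a = \int[mu]_(x in `[a, b]) g x.

(* u is (the C^1 representative of) an element of H^2(R), and u'' = g.       *)
Definition H2_deriv2 (u g : R -> R[i]) : Prop :=
  [/\ inL2 u, inL2 g,
      AC_deriv2 (@complex.Re R \o u) (@complex.Re R \o g) &
      AC_deriv2 (@complex.Im R \o u) (@complex.Im R \o g)].

(* The graph of L: u is in H^2(R) and f represents L u.                      *)
Definition schrodinger (V : R -> R) (u f : R -> R[i]) : Prop :=
  exists2 g, H2_deriv2 u g & f = (fun x => - g x + (V x)%:C * u x).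

(* L - z : H^2 -> L^2 is onto and has a bounded inverse; the estimate also   *)
(* gives injectivity.                                                        *)
Definition resolvent_set (V : R -> R) : set R[i] := [set z |
  (forall f, inL2 f -> exists u h,
     schrodinger V u h /\ {ae mu, forall x, h x - z * u x = f x}) /\
  (exists C : R, forall u h, schrodinger V u h ->
     (normL2 u <= C%:E * normL2 (fun x => (h x - z * u x)%R))%E)].

Definition spectrum (V : R -> R) : set R[i] := ~` resolvent_set V.

(* L is self-adjoint, so its spectrum is real and nothing is lost by taking  *)
(* real points only.                                                         *)
Definition spectrum_bottom (V : R -> R) (E0 : R) : Prop :=
  infimums [set E : R | spectrum V E%:C] E0.

Definition solves (V : R -> R) (E : R) (f u : R -> R) : Prop :=
  [/\ forall x, derivable u x 1, forall x, derivable (derive1 u) x 1 &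
      forall x, - derive1n 2 u x + V x * u x - E * u x = f x].

Definition coef_alpha (Psi0 Psi1 : R -> R) : R :=
  - 1 - 2 * intper (fun x => derive1 Psi1 x * Psi0 x).

Definition coef_chi (G Psi0 Psi2 : R -> R) : R :=
  3 * intper (fun x => G x * Psi0 x ^+ 3 * Psi2 x).

Definition coef_gamma (G Psi0 Psi1 Psi2 : R -> R) : R :=
  - 2 * intper (fun x => derive1 Psi2 x * Psi0 x)
  + intper (fun x => G x * Psi0 x ^+ 3 * Psi1 x).

Definition cderive (f : R -> R[i]) (x : R) : R[i] :=
  derive1 (@complex.Re R \o f) x +i* derive1 (@complex.Im R \o f) x.

(* The equations are stated at one point (X, T), so that no domain or        *)
(* regularity class for A has to be fixed.                                   *)
Definition cnls (alpha chi gamma : R) (A : R -> R -> R[i]) (X T : R) : Prop :=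
  'i * cderive (fun t => A X t) T =
    alpha%:C * cderive (cderive (fun x => A x T)) X
    + chi%:C * `|A X T| ^+ 4 * A X T
    + gamma%:C * cderive (fun x => `|A x T| ^+ 2 * A x T) X.

Definition quintic_nls (alpha chi : R) (A : R -> R -> R[i]) (X T : R) : Prop :=
  'i * cderive (fun t => A X t) T =
    alpha%:C * cderive (cderive (fun x => A x T)) X
    + chi%:C * `|A X T| ^+ 4 * A X T.

(* With this sign convention the quintic equation is focusing when its       *)
(* dispersion and nonlinearity coefficients have the same sign.              *)
Definition focusing (alpha chi : R) : Prop := 0 < alpha * chi.

End Definitions.

(* Main.v *)
Require Import Defs.
From mathcomp Require Import all_boot all_order all_algebra.
From mathcomp Require Import complex.
From mathcomp Require Import all_classical all_reals all_analysis.
From mathcomp Require Import measurable_realfun.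
From mathcomp Require Import ring lra.
Import Order.TTheory GRing.Theory Num.Theory.
Import numFieldNormedType.Exports.
Local Open Scope classical_set_scope.
Local Open Scope ring_scope.

(** Once [Psi0] is known to have no zero, everything follows by integrating exact
derivatives over a period:
- [gamma] is the mean of [(Psi2' Psi1 - Psi2 Psi1' - 2 Psi2 Psi0)'], hence 0;
- [c = Psi1' Psi0 - Psi1 Psi0' + Psi0 ^ 2] is constant and [alpha = - 2 pi c], while
  [(Psi1 / Psi0)' = (c - Psi0 ^ 2) / Psi0 ^ 2] vanishes somewhere, so [c > 0];
- by the Jacobi factorization [chi / 3] is minus the mean of
  [(Psi2' - Psi2 Psi0' / Psi0) ^ 2], which vanishes only if [Psi2] is a multiple of
  [Psi0], that is only if [G = 0].

That [Psi0] has no zero uses that [E0] is the bottom of the spectrum.  Let [m] be the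
largest constant such that [m <u, u> <= <u, L u>] for the real [C^2] functions [u]
with [u], [u''] square integrable.  If [m] were in the resolvent set, expanding the
form at [u - t (L - m)^-1 u] would improve the constant; so [m >= E0].  If [Psi0] had
a zero, the positive periodic function [sqrt (Psi0 ^ 2 + e)], cut off on a long
interval, would contradict the resulting lower bound for small [e]. *)

(** * Calculus on the line *)

(** The derivative is carried as an explicit function, so that [deriv_rule] can compute one by
    structure and [has_deriv_eq] can replace it by a chosen form, mostly by [ring] or [field]. *)
Definition has_deriv {R : realType} (f f' : R -> R) : Prop :=
  forall x : R, is_derive x (1 : R) f (f' x).

Section Calculus.
Context {R : realType}.
Implicit Types f g : R -> R.
Local Notation mu := (@lebesgue_measure R).

Lemma has_deriv_eq f f' g' : has_deriv f f' -> (forall x, f' x = g' x) -> has_deriv f g'.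
Proof. by move=> df e x; rewrite -e. Qed.

Lemma has_deriv_cst (a : R) : has_deriv (fun=> a) (fun=> 0).
Proof. by move=> x; exact: is_derive_cst. Qed.

Lemma has_deriv_id : has_deriv (fun x : R => x) (fun=> 1).
Proof. by move=> x; exact: is_derive_id. Qed.

Lemma has_derivD f f' g g' : has_deriv f f' -> has_deriv g g' ->
  has_deriv (fun x => f x + g x) (fun x => f' x + g' x).
Proof. by move=> df dg x; have := is_deriveD (df x) (dg x). Qed.

Lemma has_derivN f f' : has_deriv f f' -> has_deriv (fun x => - f x) (fun x => - f' x).
Proof. by move=> df x; have := is_deriveN (df x). Qed.

Lemma has_derivM f f' g g' : has_deriv f f' -> has_deriv g g' ->
  has_deriv (fun x => f x * g x) (fun x => f' x * g x + f x * g' x).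
Proof.
move=> df dg x; have := is_deriveM (df x) (dg x).
by rewrite /GRing.scale/= addrC (mulrC (f' x)).
Qed.

Lemma has_derivV f f' : (forall x, f x != 0) -> has_deriv f f' ->
  has_deriv (fun x => (f x)^-1) (fun x => - (f' x / f x ^+ 2)).
Proof.
move=> f0 df x; have := @is_deriveV R f x (f' x) 1 (f0 x) (df x).
by rewrite /GRing.scale/= mulNr mulrC.
Qed.

Lemma has_derivX f f' n : has_deriv f f' ->
  has_deriv (fun x => f x ^+ n) (fun x => n%:R * f x ^+ n.-1 * f' x).
Proof.
move=> df x; have := is_deriveX n (df x); rewrite /GRing.scale/=.
by rewrite (_ : f ^+ n = (fun y => f y ^+ n))// fctE.
Qed.

Lemma has_deriv_comp f f' g g' : has_deriv f f' -> has_deriv g g' ->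
  has_deriv (fun x => f (g x)) (fun x => f' (g x) * g' x).
Proof. by move=> df dg x; exact: (is_derive1_comp (df (g x)) (dg x)). Qed.

Lemma has_deriv_derivable f f' : has_deriv f f' -> forall x, derivable f x 1.
Proof. by move=> df x; case: (df x). Qed.

Lemma has_deriv_derive1 f f' : has_deriv f f' -> derive1 f = f'.
Proof.
by move=> df; apply/funext => x; rewrite derive1E; have [_ ->] := df x.
Qed.

Lemma derivable_has_deriv f : (forall x, derivable f x 1) -> has_deriv f (derive1 f).
Proof. by move=> df x; rewrite derive1E; exact: derivableP. Qed.

Lemma has_deriv_continuous f f' : has_deriv f f' -> continuous f.
Proof.
move=> df x; apply: differentiable_continuous; apply/derivable1_diffP.
exact: (has_deriv_derivable _ _ df).
Qed.

Lemma continuous_within f (A : set R) : continuous f ->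
  {within A, continuous f}.
Proof. by move=> cf; exact: continuous_subspaceT. Qed.

Lemma continuous_measurable f (A : set R) : continuous f -> measurable_fun A f.
Proof.
move=> cf; apply: (@measurable_funS _ _ _ _ setT) => //.
exact: continuous_measurable_fun.
Qed.

Lemma continuous_integrable_itv f a b : continuous f ->
  mu.-integrable `[a, b] (EFin \o f).
Proof.
move=> cf; apply: continuous_compact_integrable; first exact: segment_compact.
exact: continuous_within.
Qed.

Lemma FTC2 f F a b : a <= b -> has_deriv F f -> continuous f ->
  \int[mu]_(x in `[a, b]) f x = F b - F a.
Proof.
rewrite le_eqVlt => /predU1P[<- _ _|ab dF cf].
  by rewrite set_itv1 Rintegral_set1 subrr.
have cF := has_deriv_continuous _ _ dF.
rewrite /Rintegral (@continuous_FTC2 _ f F)//.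
- exact: continuous_within.
- split; first by move=> x _; exact: (has_deriv_derivable _ _ dF).
  + exact/cvg_at_right_filter/cF.
  + exact/cvg_at_left_filter/cF.
- by move=> x _; rewrite (has_deriv_derive1 _ _ dF).
Qed.

Lemma has_deriv0_cst f : has_deriv f (fun=> 0) -> forall x y, f x = f y.
Proof. by move=> df x y; exact: is_derive_0_is_cst. Qed.

Lemma MVT_has_deriv f f' a b : a < b -> has_deriv f f' ->
  exists2 c, a < c < b & f b - f a = f' c * (b - a).
Proof.
move=> ab df; have [c] := @MVT _ f f' a b ab (fun x _ => df x)
  (continuous_within _ _ (has_deriv_continuous _ _ df)).
by rewrite in_itv/= => ? ?; exists c.
Qed.

Lemma primitive_exists f : continuous f -> exists F, has_deriv F f.
Proof.
move=> cf; pose F (x : R) : R := if 0 <= x then \int[mu]_(t in `[0, x]) f t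
  else - \int[mu]_(t in `[x, 0]) f t.
(* Base point [- N] lies strictly below both 0 and x. The primitive [H] started there differs from
   [F] by the constant [H 0] near x, so the sign split in [F] does no harm. *)
exists F => x; pose N : R := `|x| + 1.
have N0 : - N < 0 by rewrite /N; have := normr_ge0 x; lra.
have xN : - N < x < N by rewrite -ltr_norml /N ltrDl.
pose H (y : R) := \int[mu]_(t in `[- N, y]) f t.
have intf a b := continuous_integrable_itv f a b cf.
have FE y : - N < y -> H y - H 0 = F y.
  move=> yN; rewrite /F; case: ifPn => [y0|].
    rewrite Rintegral_itvB ?bnd_simp ?(ltW N0)//.
    by rewrite Rintegral_itv_obnd_cbnd//; apply: integrableS (intf 0 y) => //;
      apply: subset_itv => //; rewrite bnd_simp.
  rewrite -ltNge => y0; rewrite -opprB; congr (- _).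
  rewrite Rintegral_itvB ?bnd_simp ?(ltW yN) ?(ltW y0)//.
  by rewrite Rintegral_itv_obnd_cbnd//; apply: integrableS (intf y 0) => //;
    apply: subset_itv => //; rewrite bnd_simp.
have [//|//|/= dH H'] := @continuous_FTC1 R f (BLeft (- N)) x N _ (intf _ _) _ (cf x).
- by case/andP: xN.
- by rewrite lte_fin; case/andP: xN.
have dHx : is_derive x 1 H (f x) by split => //; rewrite -derive1E.
apply: (@near_eq_is_derive _ _ _ (fun y => H y - H 0)).
  near=> y; apply: FE; near: y; apply: lt_nbhsr; by case/andP: xN.
have := is_deriveB dHx (is_derive_cst (H 0) x 1).
by rewrite subr0.
Unshelve. all: by end_near. Qed.

End Calculus.

Ltac deriv_rule :=
  lazymatch goal with
  | |- has_deriv (fun _ => ?a) _ => exact: has_deriv_cst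
  | |- has_deriv (fun x => x) _ => exact: has_deriv_id
  | |- has_deriv (fun x => @?f x + @?g x) _ =>
      apply: (has_derivD f _ g _); deriv_rule
  | |- has_deriv (fun x => - @?f x) _ => apply: (has_derivN f _); deriv_rule
  | |- has_deriv (fun x => @?f x * @?g x) _ =>
      apply: (has_derivM f _ g _); deriv_rule
  | |- has_deriv (fun x => @?f x ^+ ?n) _ =>
      apply: (has_derivX f _ n); deriv_rule
  | |- _ => try eassumption
  end.

Section Continuity.
Context {R : realType}.
Implicit Types f g : R -> R.

Lemma contC (a : R) : continuous (fun _ : R => a).
Proof. by move=> x; exact: cvg_cst. Qed.

Lemma contI : continuous (fun x : R => x).
Proof. by move=> x; exact: cvg_id. Qed.

Lemma contD f g : continuous f -> continuous g ->
  continuous (fun x => f x + g x).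
Proof. by move=> cf cg x; apply: cvgD; [exact: cf|exact: cg]. Qed.

Lemma contN f : continuous f -> continuous (fun x => - f x).
Proof. by move=> cf x; apply: cvgN; exact: cf. Qed.

Lemma contM f g : continuous f -> continuous g ->
  continuous (fun x => f x * g x).
Proof. by move=> cf cg x; apply: cvgM; [exact: cf|exact: cg]. Qed.

Lemma contX f n : continuous f -> continuous (fun x => f x ^+ n).
Proof.
move=> cf; elim: n => [|n ih]; first exact: contC.
rewrite (_ : (fun x => f x ^+ n.+1) = fun x => f x * f x ^+ n).
  exact: contM.
by apply/funext => x; rewrite exprS.
Qed.

Lemma contV f : (forall x, f x != 0) -> continuous f ->
  continuous (fun x => (f x)^-1).
Proof. by move=> f0 cf x; apply: cvgV => //; exact: cf. Qed.

End Continuity.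

Ltac cont_rule :=
  lazymatch goal with
  | |- continuous (fun _ => ?a) => exact: contC
  | |- continuous (fun x => x) => exact: contI
  | |- continuous (fun x => @?f x + @?g x) =>
      apply: (contD f g); cont_rule
  | |- continuous (fun x => - @?f x) => apply: (contN f); cont_rule
  | |- continuous (fun x => @?f x * @?g x) =>
      apply: (contM f g); cont_rule
  | |- continuous (fun x => @?f x ^+ ?n) => apply: (contX f n); cont_rule
  | |- _ => try assumption
  end.

(** * Integrable and square-integrable functions on the line *)

Section SquareIntegrable.
Context {R : realType}.
Implicit Types f g : R -> R.
Local Notation mu := (@lebesgue_measure R).

Definition itg f := mu.-integrable setT (EFin \o f).
Definition L2 f := itg (fun x => f x ^+ 2).

Lemma itg_dom f g : continuous f -> (forall x, `|f x| <= g x) -> itg g -> itg f.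
Proof.
move=> cf fg ig; apply: (@le_integrable _ _ _ mu setT measurableT (EFin \o f) (EFin \o g)).
  by apply/measurable_EFinP; exact: continuous_measurable.
  by move=> x _ /=; rewrite lee_fin (le_trans (fg x))// ler_norm.
exact: ig.
Qed.

Lemma itgD f g : itg f -> itg g -> itg (fun x => f x + g x).
Proof. by move=> itf itgg; have := integrableD measurableT itf itgg. Qed.

Lemma itgZ (a : R) f : itg f -> itg (fun x => a * f x).
Proof. by move=> itf; have := integrableZl measurableT a itf. Qed.

Lemma itgN f : itg f -> itg (fun x => - f x).
Proof. by move=> itf; have := integrableN itf. Qed.

Lemma itgB f g : itg f -> itg g -> itg (fun x => f x - g x).
Proof. by move=> itf itgg; apply: itgD => //; exact: itgN. Qed.

Lemma itgT_itv f a b : itg f -> mu.-integrable `[a, b] (EFin \o f).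
Proof. by apply: integrableS. Qed.

Lemma L2M f g : continuous f -> continuous g -> L2 f -> L2 g ->
  itg (fun x => f x * g x).
Proof.
move=> cf cg L2f L2g.
apply: (itg_dom _ (fun x => f x ^+ 2 + g x ^+ 2)); first by cont_rule.
  by move=> x; rewrite ler_norml; apply/andP; split; nra.
exact: itgD.
Qed.

Lemma L2_comb (a b : R) f g : continuous f -> continuous g -> L2 f -> L2 g ->
  L2 (fun x => a * f x + b * g x).
Proof.
move=> cf cg L2f L2g.
apply: (itg_dom _ (fun x => (2 * a ^+ 2) * f x ^+ 2 + (2 * b ^+ 2) * g x ^+ 2)).
- by cont_rule.
- move=> x; rewrite ger0_norm ?sqr_ge0//.
  by have := sqr_ge0 (a * f x - b * g x); nra.
- by apply: itgD; exact: itgZ.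
Qed.

Lemma L2_bounded (M : R) (h f : R -> R) : continuous h -> continuous f ->
  (forall x, `|h x| <= M) -> L2 f -> L2 (fun x => h x * f x).
Proof.
move=> ch cf hM L2f.
apply: (itg_dom _ (fun x => M ^+ 2 * f x ^+ 2)); [by cont_rule| |exact: itgZ].
move=> x; rewrite ger0_norm ?sqr_ge0// exprMn ler_wpM2r ?sqr_ge0//.
by rewrite -(real_normK (num_real (h x))) lerXn2r ?nnegrE// (le_trans _ (hM x)).
Qed.

End SquareIntegrable.

(** * Polynomial cutoffs on growing intervals *)

Section Cutoff.
Context {R : realType}.
Implicit Types f u v : R -> R.
Local Notation mu := (@lebesgue_measure R).

(** Discards the errors of order 1/n that the cutoffs leave behind. *)
Lemma cvg_ge0 (I_ : nat -> R) (I C : R) : I_ n @[n --> \oo] --> I ->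
  (forall n, - (C / n.+1%:R) <= I_ n) -> 0 <= I.
Proof.
move=> cI leI.
have c0 : (fun n => - (C * n.+1%:R^-1) : R) n @[n --> \oo] --> (0 : R).
  rewrite -[X in _ --> X]oppr0 -(mulr0 C).
  by apply: cvgN; apply: cvgMr; exact: cvg_harmonic.
exact: (ler_cvg_to c0 cI (nearW _ leI)).
Qed.

(** Dominated convergence: on its interval the cutoff lies between 0 and 1, and it tends to 1 at
    each point, so [|f|] dominates. *)
Lemma cutoff_cvg f : continuous f -> itg f ->
  (\int[mu]_(x in `[- n.+1%:R, n.+1%:R])
      ((1 - (n.+1%:R^-1 * x) ^+ 2) ^+ 2 * f x)) @[n --> \oo]
    --> \int[mu]_x f x.
Proof.
move=> cf itf.
pose g n x : R := (1 - (n.+1%:R^-1 * x) ^+ 2) ^+ 2 * f x.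
pose h n := (g n) \_ `[- n.+1%:R, n.+1%:R].
have itv n x : (`[- n.+1%:R, n.+1%:R]%classic x) -> `|n.+1%:R^-1 * x : R| <= 1.
  rewrite /= in_itv/= -ler_norml normrM ger0_norm// => xn.
  by rewrite mulrC ler_pdivrMr// mul1r.
have hx n x : `|h n x| <= `|f x|.
  rewrite /h patchE; case: ifPn => [/set_mem xn|_]; last by rewrite normr0.
  rewrite normrM -[leRHS]mul1r ler_wpM2r//.
  have := itv _ _ xn; rewrite ler_norml.
  move: (n.+1%:R^-1 * x) => t /andP[? ?]; have t1 : 0 <= t ^+ 2 <= 1 by apply/andP; split; nra.
  by case/andP: t1; move: (t ^+ 2) => y ? ?; rewrite ler_norml; apply/andP; split; nra.
have lim x : (fun n => g n x) n @[n --> \oo] --> f x.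
  have l0 : (fun n => n.+1%:R^-1 * x) n @[n --> \oo] --> (0 : R).
    by rewrite -(mul0r x); apply: cvgMl; exact: cvg_harmonic.
  pose p (y : R) : R := (1 - y ^+ 2) ^+ 2 * f x.
  have cp : continuous p by rewrite /p; cont_rule.
  have := cvg_comp _ _ l0 (cp 0).
  by rewrite {2}/p expr0n subr0 expr1n mul1r.
have mh n : measurable_fun setT (h n).
  apply/(measurable_restrictT _ _).1 => //.
  by apply: continuous_measurable; rewrite /g; cont_rule.
have inth n : itg (h n).
  apply: (@le_integrable _ _ _ mu setT measurableT _ (EFin \o f)) => //.
    by apply/measurable_EFinP; exact: mh.
  by move=> x _; rewrite /= lee_fin.
have := @dominated_cvg _ _ R mu setT measurableT (fun n => EFin \o h n)
  (EFin \o f) (EFin \o (fun x => `|f x|)).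
have -> : (fun n => \int[mu]_(x in `[- n.+1%:R, n.+1%:R])
   ((1 - (n.+1%:R^-1 * x) ^+ 2) ^+ 2 * f x)) =
   (fun n => fine (\int[mu]_x (h n x)%:E)%E).
  by apply/funext => n; rewrite Rintegral_mkcond.
move=> dom; apply: fine_cvg; rewrite fineK; last first.
  exact: integrable_fin_num.
apply: dom => //.
- by move=> n; apply/measurable_EFinP; exact: mh.
- move=> x _; apply: cvg_EFin; first exact: nearW.
  apply: cvg_trans (lim x); apply: near_eq_cvg.
  near=> n; rewrite /= /h patchE mem_set//= in_itv/= -ler_norml.
  rewrite (@le_trans _ _ n%:R)// ?ler_nat//.
  near: n; exact: nbhs_infty_ger.
- exact: integrable_norm itf.
by move=> n x _; rewrite lee_fin; exact: hx.
Unshelve. all: by end_near. Qed.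

End Cutoff.

(** * The quadratic form on the line *)

Section IntervalIntegral.
Context {R : realType}.
Implicit Types f g : R -> R.
Local Notation mu := (@lebesgue_measure R).

Lemma itv_intD f g a b : continuous f -> continuous g ->
  \int[mu]_(x in `[a, b]) (f x + g x) =
  \int[mu]_(x in `[a, b]) f x + \int[mu]_(x in `[a, b]) g x.
Proof. by move=> cf cg; apply: RintegralD => //; exact: continuous_integrable_itv. Qed.

Lemma itv_intB f g a b : continuous f -> continuous g ->
  \int[mu]_(x in `[a, b]) (f x - g x) =
  \int[mu]_(x in `[a, b]) f x - \int[mu]_(x in `[a, b]) g x.
Proof. by move=> cf cg; apply: RintegralB => //; exact: continuous_integrable_itv. Qed.

Lemma itv_intZ (k : R) f a b : continuous f ->
  \int[mu]_(x in `[a, b]) (k * f x) = k * \int[mu]_(x in `[a, b]) f x.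
Proof. by move=> cf; apply: RintegralZl => //; exact: continuous_integrable_itv. Qed.

Lemma itv_int_le f g a b : continuous f -> continuous g ->
  (forall x, a <= x <= b -> f x <= g x) ->
  \int[mu]_(x in `[a, b]) f x <= \int[mu]_(x in `[a, b]) g x.
Proof.
move=> cf cg fg; apply: le_Rintegral => //; exact: continuous_integrable_itv.
Qed.

Lemma itv_int_cst (k : R) a b : a <= b ->
  \int[mu]_(x in `[a, b]) k = k * (b - a).
Proof.
move=> ab; rewrite (FTC2 (fun=> k) (fun x => k * x) _ _ ab); first by rewrite mulrBr.
  by apply: has_deriv_eq; [deriv_rule|move=> x /=; ring].
exact: contC.
Qed.

Lemma itv_int_le_full f a b : continuous f -> itg f -> (forall x, 0 <= f x) ->
  \int[mu]_(x in `[a, b]) f x <= \int[mu]_x f x.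
Proof.
move=> cf itf f0; apply: fine_le.
- by apply: integrable_fin_num => //; exact: itgT_itv.
- by apply: integrable_fin_num => //.
- apply: ge0_subset_integral => //; last by move=> x _; rewrite lee_fin.
  by apply/measurable_EFinP; exact: continuous_measurable.
Qed.

End IntervalIntegral.

Section FormOnLine.
Context {R : realType}.
Implicit Types u v : R -> R.
Local Notation mu := (@lebesgue_measure R).
(** Vanishes at both ends of the interval, which removes boundary terms; being polynomial, it keeps
    every identity within reach of [ring]. *)
Local Notation cut n x := (1 - (n.+1%:R^-1 * x) ^+ 2).

Lemma cutoff_bounds (n : nat) (x : R) : - n.+1%:R <= x <= n.+1%:R -> 0 <= cut n x <= 1.
Proof.
rewrite -ler_norml => xn.
have : `|n.+1%:R^-1 * x| <= 1.
  by rewrite normrM ger0_norm// mulrC ler_pdivrMr// mul1r.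
rewrite ler_norml; move: (_^-1 * x) => t /andP[t1 t2].
have := mulr_ge0 (_ : 0 <= 1 - t) (_ : 0 <= 1 + t); have := sqr_ge0 t.
by move=> ? /(_ _ _)/wrap[]; [lra|lra|move=> ?; apply/andP; split; lra].
Qed.

(* The square of the cutoff vanishes with its derivative at the end points, so
   the integration by parts uses no bound on u'. *)
Lemma cutoff_energy u u1 u2 (n : nat) : has_deriv u u1 -> has_deriv u1 u2 -> continuous u2 ->
  L2 u ->
  \int[mu]_(x in `[- n.+1%:R, n.+1%:R]) (cut n x ^+ 2 * u1 x ^+ 2)
    - 4 * n.+1%:R^-1 ^+ 2 * \int[mu]_x (u x ^+ 2)
  <= \int[mu]_(x in `[- n.+1%:R, n.+1%:R]) (cut n x ^+ 2 * - (u x * u2 x)).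
Proof.
move=> du du1 cu2 L2u; set N : R := n.+1%:R; set a := N^-1.
have N0 : 0 < N by rewrite /N.
have NN : - N <= N by lra.
have aN : a * N = 1 by rewrite mulVf// gt_eqF.
have cu := has_deriv_continuous _ _ du; have cu1 := has_deriv_continuous _ _ du1.
(* The second term of [H] is chosen to cancel the mixed products [u * u1] coming from the first.
   What remains is the energy and a multiple of [u ^+ 2] whose coefficient is at most [4 * a ^+ 2]
   on the interval. *)
pose H x := - (1 - (a * x) ^+ 2) ^+ 2 * (u x * u1 x)
  - 2 * a ^+ 2 * x * (1 - (a * x) ^+ 2) * u x ^+ 2.
pose h x := (1 - (a * x) ^+ 2) ^+ 2 * - (u x * u2 x)
  - (1 - (a * x) ^+ 2) ^+ 2 * u1 x ^+ 2
  + (6 * a ^+ 4 * x ^+ 2 - 2 * a ^+ 2) * u x ^+ 2.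
have dH : has_deriv H h.
  by apply: has_deriv_eq; [rewrite /H; deriv_rule|move=> x; rewrite /h /=; ring].
have ch : continuous h by rewrite /h; cont_rule.
have h0 : \int[mu]_(x in `[- N, N]) h x = 0.
  by rewrite (FTC2 _ _ _ _ NN dH ch) /H !mulrN aN; ring.
have cA : continuous (fun x : R => (1 - (a * x) ^+ 2) ^+ 2 * u1 x ^+ 2) by cont_rule.
have cB : continuous (fun x : R => (1 - (a * x) ^+ 2) ^+ 2 * - (u x * u2 x)) by cont_rule.
have cU : continuous (fun x : R => 4 * a ^+ 2 * u x ^+ 2) by cont_rule.
have cU2 : continuous (fun x : R => u x ^+ 2) by cont_rule.
have : \int[mu]_(x in `[- N, N]) h x <= \int[mu]_(x in `[- N, N])
   ((1 - (a * x) ^+ 2) ^+ 2 * - (u x * u2 x)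
     - (1 - (a * x) ^+ 2) ^+ 2 * u1 x ^+ 2 + 4 * a ^+ 2 * u x ^+ 2).
  apply: itv_int_le => //; first by cont_rule.
  move=> x /(cutoff_bounds n) /andP[s0 s1]; rewrite /h lerD2l ler_wpM2r ?sqr_ge0//.
  have -> : 6 * a ^+ 4 * x ^+ 2 = 6 * a ^+ 2 * (a * x) ^+ 2 by ring.
  have := sqr_ge0 a; move: s0 s1; rewrite -/N -/a; move: ((a * x) ^+ 2) (a ^+ 2) => y z.
  by nra.
rewrite h0 itv_intD//; last by cont_rule.
rewrite itv_intB// itv_intZ//.
have : \int[mu]_(x in `[- N, N]) (u x ^+ 2) <= \int[mu]_x (u x ^+ 2).
  by apply: itv_int_le_full => // x; exact: sqr_ge0.
have := sqr_ge0 a; move: (\int[mu]_(x in _) (u x ^+ 2)) => I1 a20 I12.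
by have := ler_wpM2l (mulr_ge0 (ler0n _ 4) a20) I12; lra.
Qed.

(** The Wronskian [u * v1 - v * u1] has derivative [u * v2 - v * u2]. Integrating by parts against
    the squared cutoff moves the derivative to the cutoff, which gains a factor of order 1/N. *)
Lemma cutoff_wronskian u u1 u2 v v1 v2 (n : nat) :
  has_deriv u u1 -> has_deriv u1 u2 -> continuous u2 ->
  has_deriv v v1 -> has_deriv v1 v2 -> continuous v2 ->
  \int[mu]_(x in `[- n.+1%:R, n.+1%:R]) (cut n x ^+ 2 * (u x * v2 x - v x * u2 x))
  <= \int[mu]_(x in `[- n.+1%:R, n.+1%:R])
     (2 * n.+1%:R^-1 * (u x ^+ 2 + v x ^+ 2 + cut n x ^+ 2 * u1 x ^+ 2
       + cut n x ^+ 2 * v1 x ^+ 2)).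
Proof.
move=> du du1 cu2 dv dv1 cv2; set N : R := n.+1%:R; set a := N^-1.
have N0 : 0 < N by rewrite /N.
have NN : - N <= N by lra.
have aN : a * N = 1 by rewrite mulVf// gt_eqF.
have a0 : 0 <= a by rewrite invr_ge0 ltW.
have cu := has_deriv_continuous _ _ du; have cu1 := has_deriv_continuous _ _ du1.
have cv := has_deriv_continuous _ _ dv; have cv1 := has_deriv_continuous _ _ dv1.
pose H x := (1 - (a * x) ^+ 2) ^+ 2 * (u x * v1 x - v x * u1 x).
pose k x := 4 * a ^+ 2 * x * (1 - (a * x) ^+ 2) * (u x * v1 x - v x * u1 x).
pose h x := (1 - (a * x) ^+ 2) ^+ 2 * (u x * v2 x - v x * u2 x) - k x.
have dH : has_deriv H h.
  by apply: has_deriv_eq; [rewrite /H; deriv_rule|move=> x; rewrite /h /k /=; ring].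
have ck : continuous k by rewrite /k; cont_rule.
have ch : continuous h by rewrite /h; cont_rule.
have h0 : \int[mu]_(x in `[- N, N]) h x = 0.
  by rewrite (FTC2 _ _ _ _ NN dH ch) /H !mulrN aN; ring.
move: h0; rewrite itv_intB//; last by cont_rule.
move/eqP; rewrite subr_eq0 => /eqP ->.
apply: itv_int_le => //; first by cont_rule.
move=> x xN; have /andP[s0 s1] := cutoff_bounds n x xN.
move: s0 s1; rewrite -/N -/a /k => s0 s1.
have -> : 4 * a ^+ 2 * x * (1 - (a * x) ^+ 2) * (u x * v1 x - v x * u1 x) =
  2 * a * (2 * (a * x) * (1 - (a * x) ^+ 2) * (u x * v1 x - v x * u1 x)) by ring.
apply: ler_wpM2l; first by lra.
move: (a * x) s0 s1 => y s0 s1.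
have y1 : y ^+ 2 <= 1 by lra.
(* [A] and [B] are Young's inequality with one cutoff factor kept on each derivative, since only the
   weighted derivatives are controlled. *)
have A := sqr_ge0 (y * u x - (1 - y ^+ 2) * v1 x).
have B := sqr_ge0 (y * v x + (1 - y ^+ 2) * u1 x).
have C := ler_wpM2r (sqr_ge0 (u x)) y1.
have D := ler_wpM2r (sqr_ge0 (v x)) y1.
by lra.
Qed.

(** Drop the nonnegative energy from [cutoff_energy]: the truncated integrals are at least
    [- 4 <u, u> / N ^ 2], and they converge to the full one. *)
Lemma form_ge0 u u1 u2 : has_deriv u u1 -> has_deriv u1 u2 -> continuous u2 ->
  L2 u -> L2 u2 -> 0 <= \int[mu]_x - (u x * u2 x).
Proof.
move=> du du1 cu2 L2u L2u2.
have cu := has_deriv_continuous _ _ du; have cu1 := has_deriv_continuous _ _ du1.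
have ig : itg (fun x => - (u x * u2 x)) by apply: itgN; exact: L2M.
have cg : continuous (fun x => - (u x * u2 x)) by cont_rule.
apply: (cvg_ge0 _ _ (4 * \int[mu]_x (u x ^+ 2)) (cutoff_cvg _ cg ig)) => n.
apply: le_trans (cutoff_energy _ _ _ n du du1 cu2 L2u).
have : 0 <= \int[mu]_(x in `[- n.+1%:R, n.+1%:R]) (cut n x ^+ 2 * u1 x ^+ 2).
  by apply: Rintegral_ge0 => x _; rewrite mulr_ge0 ?sqr_ge0.
have : 0 <= \int[mu]_x (u x ^+ 2) by apply: Rintegral_ge0 => x _; exact: sqr_ge0.
have n1 : n.+1%:R^-1 ^+ 2 <= n.+1%:R^-1 :> R.
  by rewrite expr2 ger_pMl// invf_le1// ler1n.
move: (\int[mu]_x (u x ^+ 2)) (\int[mu]_(x in _) (cut n x ^+ 2 * _)) n1 => U A.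
move: (n.+1%:R^-1) => a a2 U0 A0; have := ler_wpM2r U0 a2; lra.
Qed.

(** Stands in for square integrability of [u1]: [cutoff_energy] combined with
    [- u u'' <= u ^ 2 + u'' ^ 2] gives a bound uniform in n. *)
Lemma cutoff_energy_bounded u u1 u2 : has_deriv u u1 -> has_deriv u1 u2 ->
  continuous u2 -> L2 u -> L2 u2 -> exists K, forall n,
  \int[mu]_(x in `[- n.+1%:R, n.+1%:R]) (cut n x ^+ 2 * u1 x ^+ 2) <= K.
Proof.
move=> du du1 cu2 L2u L2u2.
have cu := has_deriv_continuous _ _ du; have cu1 := has_deriv_continuous _ _ du1.
exists (\int[mu]_x (u x ^+ 2 + u2 x ^+ 2) + 4 * \int[mu]_x (u x ^+ 2)) => n.
have := cutoff_energy _ _ _ n du du1 cu2 L2u.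
have : \int[mu]_(x in `[- n.+1%:R, n.+1%:R]) (cut n x ^+ 2 * - (u x * u2 x)) <=
    \int[mu]_(x in `[- n.+1%:R, n.+1%:R]) (u x ^+ 2 + u2 x ^+ 2).
  apply: itv_int_le; [by cont_rule|by cont_rule|].
  move=> x /(cutoff_bounds n)/andP[]; move: (cut n x) => s s0 s1.
  have s2 : 0 <= s ^+ 2 <= 1 by rewrite sqr_ge0/=; nra.
  case/andP: s2; move: (s ^+ 2) => {s s0 s1} s s0 s1.
  have := sqr_ge0 (u x + u2 x); have := sqr_ge0 (u x); have := sqr_ge0 (u2 x).
  by nra.
have : \int[mu]_(x in `[- n.+1%:R, n.+1%:R]) (u x ^+ 2 + u2 x ^+ 2) <=
  \int[mu]_x (u x ^+ 2 + u2 x ^+ 2).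
  apply: itv_int_le_full; [by cont_rule|exact: itgD|].
  by move=> x; rewrite addr_ge0 ?sqr_ge0.
have : 0 <= \int[mu]_x (u x ^+ 2) by apply: Rintegral_ge0 => x _; exact: sqr_ge0.
have n1 : n.+1%:R^-1 ^+ 2 <= 1 :> R.
  by rewrite exprn_ile1// invf_le1// ler1n.
move: (\int[mu]_x (u x ^+ 2)) n1 => U; move: (n.+1%:R^-1 ^+ 2) => a a1 U0 ? ? ?.
have := ler_wpM2r U0 a1; lra.
Qed.

(** By [cutoff_energy_bounded], the right-hand side of [cutoff_wronskian] is of order 1/n. The limit
    gives one inequality; exchanging u and v gives the other in [form_sym]. *)
Lemma form_sym_le u u1 u2 v v1 v2 :
  has_deriv u u1 -> has_deriv u1 u2 -> continuous u2 -> L2 u -> L2 u2 ->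
  has_deriv v v1 -> has_deriv v1 v2 -> continuous v2 -> L2 v -> L2 v2 ->
  \int[mu]_x (v x * u2 x) <= \int[mu]_x (u x * v2 x).
Proof.
move=> du du1 cu2 L2u L2u2 dv dv1 cv2 L2v L2v2.
have cu := has_deriv_continuous _ _ du; have cu1 := has_deriv_continuous _ _ du1.
have cv := has_deriv_continuous _ _ dv; have cv1 := has_deriv_continuous _ _ dv1.
have iuv := L2M _ _ cu cv2 L2u L2v2; have ivu := L2M _ _ cv cu2 L2v L2u2.
rewrite -subr_ge0 -RintegralB//.
have cg : continuous (fun x => u x * v2 x - v x * u2 x) by cont_rule.
have [K HK] := cutoff_energy_bounded _ _ _ du du1 cu2 L2u L2u2.
have [L HL] := cutoff_energy_bounded _ _ _ dv dv1 cv2 L2v L2v2.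
apply: (cvg_ge0 _ _ (2 * (\int[mu]_x (u x ^+ 2) + \int[mu]_x (v x ^+ 2) + K + L))
  (cutoff_cvg _ cg (itgB _ _ iuv ivu))) => n.
have := cutoff_wronskian _ _ _ _ _ _ n dv dv1 cv2 du du1 cu2.
have c1 : continuous (fun x => u x ^+ 2) by cont_rule.
have c2 : continuous (fun x => v x ^+ 2) by cont_rule.
have c3 : continuous (fun x : R => cut n x ^+ 2 * u1 x ^+ 2) by cont_rule.
have c4 : continuous (fun x : R => cut n x ^+ 2 * v1 x ^+ 2) by cont_rule.
rewrite itv_intZ; last by cont_rule.
rewrite itv_intD//; last by cont_rule.
rewrite itv_intD//; last by cont_rule.
rewrite itv_intD//.
have : \int[mu]_(x in `[- n.+1%:R, n.+1%:R]) (u x ^+ 2) <= \int[mu]_x (u x ^+ 2).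
  by apply: itv_int_le_full => // x; exact: sqr_ge0.
have : \int[mu]_(x in `[- n.+1%:R, n.+1%:R]) (v x ^+ 2) <= \int[mu]_x (v x ^+ 2).
  by apply: itv_int_le_full => // x; exact: sqr_ge0.
move=> b2 b1; have := HL n; have := HK n; move: b1 b2.
have -> : \int[mu]_(x in `[- n.+1%:R, n.+1%:R])
    (cut n x ^+ 2 * (u x * v2 x - v x * u2 x)) =
  - \int[mu]_(x in `[- n.+1%:R, n.+1%:R])
    (cut n x ^+ 2 * (v x * u2 x - u x * v2 x)).
  rewrite -[RHS]mulN1r.
  rewrite -(itv_intZ (-1) (fun x => cut n x ^+ 2 * (v x * u2 x - u x * v2 x))).
    by apply: eq_Rintegral => x _; ring.
  by cont_rule.
move=> ? ? ? ? h5; rewrite lerN2; apply: le_trans h5 _.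
rewrite [leRHS]mulrAC; apply: ler_wpM2l; [by rewrite mulr_ge0|lra].
Qed.

Lemma form_sym u u1 u2 v v1 v2 :
  has_deriv u u1 -> has_deriv u1 u2 -> continuous u2 -> L2 u -> L2 u2 ->
  has_deriv v v1 -> has_deriv v1 v2 -> continuous v2 -> L2 v -> L2 v2 ->
  \int[mu]_x (v x * u2 x) = \int[mu]_x (u x * v2 x).
Proof.
by move=> *; apply/eqP; rewrite eq_le; apply/andP; split;
  eapply form_sym_le; eassumption.
Qed.

End FormOnLine.

(** * Resolvent and spectral bottom *)

Section Resolvent.
Local Open Scope complex_scope.
Context {R : realType}.
Local Notation mu := (@lebesgue_measure R).

Lemma ae_imply (P Q : R -> Prop) : (forall x, P x -> Q x) ->
  {ae mu, forall x, P x} -> {ae mu, forall x, Q x}.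
Proof.
by move=> PQ; apply: (@filterS _ _ (ae_filter_ringOfSetsType mu)).
Qed.

Lemma Lfun_measurable (f : R -> R) : f \in Lfun mu 2%:E -> measurable_fun setT f.
Proof. by rewrite inE => /andP[mf _]; move: mf; rewrite inE. Qed.

Lemma L2_Lfun (f : R -> R) : continuous f -> L2 f -> f \in Lfun mu 2%:E.
Proof.
move=> cf L2f; rewrite inE; apply/andP; split; rewrite inE/=.
  exact: continuous_measurable.
rewrite /finite_norm unlock; apply: poweR_lty.
have /integrableP[_] := L2f.
congr (_ < _)%E; apply: eq_integral => x _ /=.
by rewrite normrX -powR_mulrn.
Qed.

Lemma normL2_sqr (w : R -> R[i]) : (normL2 w `^ 2 =
  \int[mu]_x (complex.Re (w x) ^+ 2 + complex.Im (w x) ^+ 2)%:E)%E.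
Proof.
rewrite /normL2 poweR_Lnorm//; apply: eq_integral => x _.
case: (w x) => a b /=.
by rewrite ger0_norm ?sqrtr_ge0// powR_mulrn ?sqrtr_ge0// sqr_sqrtr// addr_ge0 ?sqr_ge0.
Qed.

Lemma normL2_real (f : R -> R) : L2 f ->
  (normL2 (fun x => (f x)%:C) `^ 2 = (\int[mu]_x (f x ^+ 2))%:E)%E.
Proof.
move=> L2f; rewrite normL2_sqr fineK; last exact: integrable_fin_num.
by apply: eq_integral => x _ /=; rewrite expr0n addr0.
Qed.

(** Regularity: u' has the same increments as a primitive of the continuous function q, so a weak
    second derivative becomes a classical one. *)
Lemma AC_deriv2_continuous (u g q : R -> R) : AC_deriv2 u g ->
  measurable_fun setT g -> continuous q -> {ae mu, forall x, g x = q x} ->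
  has_deriv (derive1 u) q.
Proof.
move=> [_ ACu] mg cq gq; have [Q dQ] := primitive_exists _ cq.
have incr a b : a <= b -> derive1 u b - derive1 u a = Q b - Q a.
  move=> ab; have [ig ->] := ACu a b ab; rewrite -(FTC2 _ _ _ _ ab dQ cq).
  congr fine; apply: ae_eq_integral => //.
  - by apply/measurable_EFinP; exact: measurable_funTS.
  - by apply/measurable_EFinP; exact: continuous_measurable.
  - by apply: ae_imply gq => x -> _.
have -> : derive1 u = fun x => Q x + (derive1 u 0 - Q 0).
  apply/funext => x; have [x0|/ltW x0] := leP x 0; have := incr _ _ x0; lra.
by apply: has_deriv_eq; [deriv_rule; exact: dQ|move=> x /=; rewrite addr0].
Qed.

(** As V and E are real, the real part of the complex solution solves the equation with the real
    datum f. The constant is [|C| ^+ 2] because the norms are squared and the given C carries no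
    sign. *)
Lemma resolvent_real (V : R -> R) (M E : R) : continuous V ->
  (forall x, `|V x| <= M) -> resolvent_set V E%:C ->
  exists2 C : R, 0 <= C & forall f : R -> R, continuous f -> L2 f ->
  exists v v1 v2 : R -> R,
   [/\ [/\ has_deriv v v1, has_deriv v1 v2, continuous v2, L2 v & L2 v2],
    forall x, - v2 x + V x * v x - E * v x = f x &
    \int[mu]_x (v x ^+ 2) <= C * \int[mu]_x (f x ^+ 2)].
Proof.
move=> cV VM [surj [C bnd]]; exists (`|C| ^+ 2); first exact: sqr_ge0.
move=> f cf L2f.
have inf : inL2 (fun x => (f x)%:C).
  split; first exact: L2_Lfun.
  rewrite (_ : _ \o _ = cst 0)//; apply: L2_Lfun; first exact: contC.
  rewrite /L2 (_ : (fun x : R => cst 0 x ^+ 2) = cst 0).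
    exact: integrable0.
  by apply/funext => x; rewrite expr0n.
have [u [h [sch hf]]] := surj _ inf; have bu := bnd _ _ sch.
case: sch => g [[uR uI] [gR gI] ACR ACI] hE.
set v := @complex.Re R \o u; set w := @complex.Im R \o u.
set gr := @complex.Re R \o g; set gi := @complex.Im R \o g.
have dv : has_deriv v (derive1 v).
  by apply: derivable_has_deriv; case: ACR.
have cv := has_deriv_continuous _ _ dv.
have L2v : L2 v by exact: Lfun2_integrable_sqr.
(* The second derivative that the equation prescribes almost everywhere. It is continuous, hence v
   is of class C^2. *)
pose q x := V x * v x - E * v x - f x.
have cq : continuous q by rewrite /q; cont_rule.
have resE x : h x - E%:C * u x =
    (- gr x + V x * v x - E * v x) +i* (- gi x + V x * w x - E * w x).
  rewrite hE /v /w /gr /gi /=; case: (u x) (g x) => [a b] [c d] /=.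
  by simpc.
have gq : {ae mu, forall x, gr x = q x}.
  apply: ae_imply hf => x; rewrite resE => -[+ _]; rewrite /q; lra.
have dv1 : has_deriv (derive1 v) q.
  by apply: AC_deriv2_continuous ACR _ cq gq; exact: Lfun_measurable.
have L2q : L2 q.
  have VE x : `|V x - E| <= M + `|E|.
    by rewrite (le_trans (ler_normB _ _))// lerD2r.
  have cVE : continuous (fun x => V x - E) by cont_rule.
  have := L2_comb 1 (-1) _ _ _ cf (L2_bounded _ _ _ cVE cv VE L2v) L2f.
  have -> : (fun x => 1 * ((V x - E) * v x) + -1 * f x) = q.
    by apply/funext => x; rewrite /q; ring.
  by apply; cont_rule.
exists v, (derive1 v), q; split; [by []|by move=> x; rewrite /q; ring|].
have mv := Lfun_measurable _ uR; have mw := Lfun_measurable _ uI.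
have mgr := Lfun_measurable _ gR; have mgi := Lfun_measurable _ gI.
have mV : measurable_fun setT V by exact: continuous_measurable.
have res2 : (normL2 (fun x => (h x - E%:C * u x)%R) `^ 2 =
    (\int[mu]_x (f x ^+ 2))%:E)%E.
  rewrite -normL2_real// !normL2_sqr; apply: ae_eq_integral => //.
  - apply/measurable_EFinP; under eq_fun do rewrite resE/=.
    apply: measurable_funD; apply: measurable_funX;
    by repeat first [exact: measurable_funTS | apply: measurable_funB
      | apply: measurable_funD | apply: measurable_funM
      | apply: measurable_oppr | exact: measurable_cst
      | apply: measurableT_comp ].
  - apply/measurable_EFinP => /=; apply: measurable_funD; apply: measurable_funX => //.
    exact: continuous_measurable.
  - by apply: ae_imply hf => x -> _.
have v2 : ((\int[mu]_x (v x ^+ 2))%:E <= normL2 u `^ 2)%E.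
  rewrite normL2_sqr fineK; last exact: integrable_fin_num.
  apply: ge0_le_integral => //.
  - by move=> x _; rewrite lee_fin sqr_ge0.
  - by apply/measurable_EFinP; exact: measurable_funX.
  - by apply/measurable_EFinP; apply: measurable_funD; exact: measurable_funX.
  - by move=> x _; rewrite lee_fin lerDl sqr_ge0.
have N0 (z : R -> R[i]) : (0 <= normL2 z)%E by exact: Lnorm_ge0.
have {}bu : (normL2 u <= `|C|%:E * normL2 (fun x => (h x - E%:C * u x)%R))%E.
  apply: le_trans bu _; rewrite lee_wpmul2r// lee_fin ler_norm.
  by [].
rewrite -lee_fin; apply: le_trans v2 _; rewrite EFinM -res2.
have -> : (`|C| ^+ 2)%:E = (`|C|%:E `^ 2)%E.
  by rewrite poweR_EFin powR_mulrn.
rewrite -poweRM ?lee_fin//.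
apply: gt0_ler_poweR => //; rewrite in_itv/= leey andbT//.
by rewrite mule_ge0 ?lee_fin.
Qed.

End Resolvent.

(** * Lower bounds of the quadratic form *)

Section FormBound.
Local Open Scope complex_scope.
Context {R : realType}.
Local Notation mu := (@lebesgue_measure R).
Implicit Types (V u : R -> R) (E : R).

(** The test class contains the solutions produced by [resolvent_real] and is stable under linear
    combinations, as the variation in [form_ge_resolvent] requires. *)
Definition form_ge V E := forall u u1 u2, has_deriv u u1 -> has_deriv u1 u2 ->
  continuous u2 -> L2 u -> L2 u2 ->
  E * \int[mu]_x (u x ^+ 2) <= \int[mu]_x (u x * (- u2 x + V x * u x)).

Lemma L2_schrodinger V M u u2 : continuous V -> (forall x, `|V x| <= M) ->
  continuous u -> continuous u2 -> L2 u -> L2 u2 ->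
  L2 (fun x => - u2 x + V x * u x).
Proof.
move=> cV VM cu cu2 L2u L2u2; have cVu := contM _ _ cV cu.
have := L2_comb (-1) 1 _ _ cu2 cVu L2u2 (L2_bounded _ _ _ cV cu VM L2u).
by congr L2; apply/funext => x; ring.
Qed.

(** The kinetic part is nonnegative by [form_ge0]. This makes the set of lower bounds nonempty. *)
Lemma form_ge_potential V M : continuous V -> (forall x, `|V x| <= M) ->
  form_ge V (- M).
Proof.
move=> cV VM u u1 u2 du du1 cu2 L2u L2u2.
have cu := has_deriv_continuous _ _ du.
have L2Vu := L2_bounded _ _ _ cV cu VM L2u.
have i1 : itg (fun x => - (u x * u2 x)) by apply: itgN; exact: L2M.
have i2 : itg (fun x => u x * (V x * u x)).
  by apply: L2M => //; cont_rule.
have -> : \int[mu]_x (u x * (- u2 x + V x * u x)) =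
    \int[mu]_x (- (u x * u2 x)) + \int[mu]_x (u x * (V x * u x)).
  by rewrite -RintegralD//; apply: eq_Rintegral => x _; ring.
have := form_ge0 _ _ _ du du1 cu2 L2u L2u2.
suff : - M * \int[mu]_x (u x ^+ 2) <= \int[mu]_x (u x * (V x * u x)) by lra.
rewrite -RintegralZl//; apply: le_Rintegral => //; first exact: itgZ.
move=> x _; have -> : u x * (V x * u x) = V x * u x ^+ 2 by ring.
rewrite ler_wpM2r ?sqr_ge0//.
by have := VM x; rewrite ler_norml => /andP[].
Qed.

(* With [v] the preimage of [u], expand the form at [u - v / K], where [K] is
   chosen so that [<u, v> <= K <u, u>]. *)
Lemma form_ge_resolvent V M E : continuous V -> (forall x, `|V x| <= M) ->
  form_ge V E -> resolvent_set V E%:C -> exists2 k, 0 < k & form_ge V (E + k).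
Proof.
move=> cV VM fE rE; have [C C0 inv] := resolvent_real _ _ _ cV VM rE.
(* From [<u, v> <= (<u, u> + <v, v>) / 2] and [<v, v> <= C <u, u>]. *)
pose K := (1 + C) / 2; have K0 : 0 < K by rewrite /K; lra.
exists K^-1; first by rewrite invr_gt0.
move=> u u1 u2 du du1 cu2 L2u L2u2; have cu := has_deriv_continuous _ _ du.
have [v [v1 [v2 [[dv dv1 cv2 L2v L2v2] vE vC]]]] := inv u cu L2u.
have cv := has_deriv_continuous _ _ dv.
pose t : R := - K^-1.
have dw : has_deriv (fun x => 1 * u x + t * v x) (fun x => 1 * u1 x + t * v1 x).
  by apply: has_deriv_eq; [deriv_rule|move=> x /=; ring].
have dw1 : has_deriv (fun x => 1 * u1 x + t * v1 x) (fun x => 1 * u2 x + t * v2 x).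
  by apply: has_deriv_eq; [deriv_rule|move=> x /=; ring].
have cw : continuous (fun x => 1 * u x + t * v x) by cont_rule.
have cw2 : continuous (fun x => 1 * u2 x + t * v2 x) by cont_rule.
have := fE _ _ _ dw dw1 cw2 (L2_comb 1 t _ _ cu cv L2u L2v)
  (L2_comb 1 t _ _ cu2 cv2 L2u2 L2v2).
pose l x := - u2 x + V x * u x.
have cl : continuous l by rewrite /l; cont_rule.
have L2l : L2 l by exact: L2_schrodinger.
have iuu : itg (fun x => u x ^+ 2) by [].
have ivv : itg (fun x => v x ^+ 2) by [].
have iul := L2M _ _ cu cl L2u L2l.
have iuv := L2M _ _ cu cv L2u L2v.
have ivl := L2M _ _ cv cl L2v L2l.
have iuv2 := L2M _ _ cu cv2 L2u L2v2.
have ivu2 := L2M _ _ cv cu2 L2v L2u2.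
set N := \int[mu]_x (u x ^+ 2); set A := \int[mu]_x (u x * l x).
set B := \int[mu]_x (u x * v x); set D := \int[mu]_x (v x ^+ 2).
(* Symmetry moves L from u to v, where [L v = u + E v]. *)
have vl : \int[mu]_x (v x * l x) = N + E * B.
  have -> : \int[mu]_x (v x * l x) = \int[mu]_x
      (u x ^+ 2 + E * (u x * v x) + (u x * v2 x - v x * u2 x)).
    by apply: eq_Rintegral => x _; have := vE x; rewrite /l => <-; ring.
  rewrite RintegralD//; [|by apply: itgD => //; exact: itgZ|exact: itgB].
  rewrite RintegralB// (form_sym _ _ _ _ _ _ du du1 cu2 L2u L2u2 dv dv1 cv2 L2v L2v2).
  by rewrite subrr addr0 RintegralD// ?RintegralZl//; exact: itgZ.
have -> : \int[mu]_x ((1 * u x + t * v x) ^+ 2) = N + 2 * t * B + t ^+ 2 * D.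
  rewrite -!RintegralZl// -!RintegralD//; do ?[exact: itgZ|apply: itgD => //].
  by apply: eq_Rintegral => x _; ring.
have -> : \int[mu]_x ((1 * u x + t * v x) *
    (- (1 * u2 x + t * v2 x) + V x * (1 * u x + t * v x))) =
    A + t * (N + E * B) + t * (N + E * B) + t ^+ 2 * (B + E * D).
  have -> : A + t * (N + E * B) + t * (N + E * B) + t ^+ 2 * (B + E * D) =
    A + t * \int[mu]_x (v x * l x) + t * N + (t * E + t ^+ 2) * B + t ^+ 2 * E * D.
    by rewrite vl; ring.
  rewrite -!RintegralZl// -!RintegralD//; do ?[exact: itgZ|apply: itgD => //].
  by apply: eq_Rintegral => x _; have := vE x; rewrite /l => <-; ring.
have BK : B <= K * N.
  have : B <= 2^-1 * (N + D).
    rewrite /B /N /D -RintegralD// -RintegralZl//; last exact: itgD.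
    apply: le_Rintegral => //; first by apply: itgZ; exact: itgD.
    by move=> x _; have := sqr_ge0 (u x - v x); lra.
  by move: vC; rewrite /K -/N -/D; lra.
move=> h; rewrite -/N -/A mulrDl.
(* The terms in [E * B] and [E * D] cancel. With [t = - 1 / K] the linear term gains [2 N / K] and
   the quadratic one costs at most [N / K]. *)
have h2 : 0 <= A - E * N + 2 * t * N + t ^+ 2 * B by lra.
have tK : t ^+ 2 * B <= K^-1 * N.
  have := ler_wpM2l (sqr_ge0 t) BK.
  by rewrite /t sqrrN expr2 mulrA mulrVK// ?unitfE ?gt_eqF// -mulrA.
move: h2 tK; rewrite {1}/t; move: (t ^+ 2 * B) (K^-1) => Z k.
by rewrite /A /N /l; lra.
Qed.

Lemma form_ge_le V E E' : E' <= E -> form_ge V E -> form_ge V E'.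
Proof.
move=> EE fE u u1 u2 du du1 cu2 L2u L2u2.
apply: le_trans (fE _ _ _ du du1 cu2 L2u L2u2); apply: ler_wpM2r => //.
by apply: Rintegral_ge0 => x _; exact: sqr_ge0.
Qed.

Lemma form_ge_sup V (S : set R) : has_sup S -> (forall E, S E -> form_ge V E) ->
  form_ge V (sup S).
Proof.
move=> supS fS u u1 u2 du du1 cu2 L2u L2u2.
have N0 : 0 <= \int[mu]_x (u x ^+ 2) by apply: Rintegral_ge0 => x _; exact: sqr_ge0.
have {}fS E (SE : S E) := fS E SE _ _ _ du du1 cu2 L2u L2u2.
have [[E SE] _] := supS.
move: N0; rewrite le_eqVlt => /predU1P[N0|N0].
  by have := fS E SE; rewrite -N0 !mulr0.
rewrite -ler_pdivlMr//; apply: ge_sup; first by exists E.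
by move=> F SF; rewrite ler_pdivlMr//; exact: fS.
Qed.

(** Lower bounds of the form are closed downwards, so if [E0] is not one, they all lie below it.
    Their supremum is again a lower bound and lies in the resolvent set, and [form_ge_resolvent]
    pushes beyond it. *)
Lemma spectrum_bottom_form_ge V M E0 : continuous V -> (forall x, `|V x| <= M) ->
  spectrum_bottom V E0 -> form_ge V E0.
Proof.
move=> cV VM [lbE _]; apply: contrapT => nE0.
have res E : E < E0 -> resolvent_set V E%:C.
  move=> EE0; apply: contrapT => sE; have := lbE E sE; lra.
pose S : set R := [set E | form_ge V E].
have ubE0 : ubound S E0.
  move=> E SE; rewrite leNgt; apply/negP => E0E.
  by apply: nE0; apply: form_ge_le SE; exact: ltW.
have supS : has_sup S.
  by split; [exists (- M); exact: form_ge_potential VM|exists E0].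
have fm : form_ge V (sup S) by exact: form_ge_sup.
have mE0 : sup S < E0.
  rewrite lt_neqAle; apply/andP; split; last first.
    by apply: ge_sup => //; case: supS.
  by apply/eqP => mE; apply: nE0; rewrite -mE.
have [k k0 fk] := form_ge_resolvent _ _ _ cV VM fm (res _ mE0).
have := ub_le_sup supS.2 fk; lra.
Qed.

End FormBound.

(** * Positivity of the ground state *)

Section Periodic.
Context {R : realType}.
Local Notation mu := (@lebesgue_measure R).
Implicit Types (f q F : R -> R) (T : R).

Lemma periodic_reduce T x : 0 < T -> exists2 y, 0 <= y <= T &
  forall f, periodic f T -> f x = f y.
Proof.
move=> T0; pose z := Num.floor (x / T); exists (x - z%:~R * T).
  have /andP[z1 z2] := floor_itv (x / T); rewrite -/z in z1 z2.
  move: z1 z2; rewrite ler_pdivlMr// ltr_pdivrMr// intrD mulrDl mul1r => ? ?.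
  by apply/andP; split; lra.
move=> f fT; case: z => n.
  by rewrite -[in LHS](subrK (n%:R * T) x) mulr_natl periodicn.
by rewrite NegzE mulrNz mulNr opprK mulr_natl periodicn.
Qed.

Lemma periodic_bounded T f : 0 < T -> continuous f -> periodic f T ->
  exists M, forall x, `|f x| <= M.
Proof.
move=> T0 cf fT; have cn : continuous (fun x => `|f x|).
  by move=> x; apply: (cvg_norm (cf x)).
have [c _ cM] := EVT_max (ltW T0) (continuous_within _ _ cn).
exists `|f c| => x; have [y y0T ->//] := periodic_reduce T x T0.
by apply: cM; rewrite in_itv.
Qed.

(** The increment over a period has derivative [q (x + T) - q x = 0]. *)
Lemma primitive_periodic T q F : periodic q T -> has_deriv F q ->
  forall x y, F (x + T) - F x = F (y + T) - F y.
Proof.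
move=> qT dF; apply: has_deriv0_cst.
have dT : has_deriv (fun x : R => x + T) (fun=> 1).
  by apply: has_deriv_eq; [deriv_rule|move=> x /=; rewrite addr0].
have dFT : has_deriv (fun x => F (x + T)) q.
  apply: has_deriv_eq; first exact: (has_deriv_comp _ _ _ _ dF dT).
  by move=> x /=; rewrite mulr1.
by apply: has_deriv_eq; [deriv_rule|move=> x /=; rewrite subrr].
Qed.

End Periodic.

(** * Compactly supported test functions and the mean energy *)

Section TestFunction.
Context {R : realType}.
Local Notation mu := (@lebesgue_measure R).

Lemma cont_max0 : continuous (fun x : R => Num.max 0 x).
Proof.
by move=> x; apply: (@continuous_max _ _ (cst 0) id); [exact: cvg_cst|exact: cvg_id].
Qed.

(** Used for n = 1 and n = 0: the cube of a truncated cutoff is then of class C^2 on the whole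
    line. *)
Lemma has_deriv_max0X n : has_deriv (fun x : R => Num.max 0 x ^+ n.+2)
  (fun x => n.+2%:R * Num.max 0 x ^+ n.+1).
Proof.
move=> x; have [x0|x0|->] := ltgtP x 0.
- rewrite (_ : _ * _ = 0); last by rewrite expr0n/= mulr0.
  apply: (near_eq_is_derive _ (has_deriv_cst 0 x)).
  by near=> y; rewrite max_l ?expr0n//= ltW//; near: y; exact: lt_nbhsl.
- have dX : has_deriv (fun y : R => y ^+ n.+2) (fun y => n.+2%:R * y ^+ n.+1).
    by apply: has_deriv_eq; [deriv_rule|move=> y /=; rewrite mulr1].
  apply: (near_eq_is_derive _ (dX x)).
  by near=> y; rewrite max_r// ltW//; near: y; exact: lt_nbhsr.
- rewrite (_ : _ * _ = 0); last by rewrite expr0n/= mulr0.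
  (* the difference quotient at 0 is h ^ n * max 0 h *)
  have ck : continuous (fun h : R => h ^+ n * Num.max 0 h).
    by apply: contM; [apply: contX; exact: contI|exact: cont_max0].
  have lim : (h : R)^-1 *: (Num.max 0 (h *: (1 : R) + 0 : R) ^+ n.+2 - Num.max 0 0 ^+ n.+2)
      @[h --> 0^'] --> (0 : R).
    have : (fun h : R => h ^+ n * Num.max 0 h) h @[h --> (0 : R)^'] --> (0 : R).
      apply: cvg_within_filter.
      by have := ck 0; rewrite /continuous_at maxxx mulr0.
    apply: cvg_trans.
    apply: near_eq_cvg; near=> h.
    have h0 : h != 0 by near: h; exact: nbhs_dnbhs_neq.
    rewrite maxxx expr0n subr0 addr0 /GRing.scale/= mulr1.
    case: (ltP 0 h) => [hp|hn]; last by rewrite expr0n !mulr0.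
    by rewrite -exprSr [h ^+ n.+2]exprS mulKf.
  split; first by apply/cvg_ex; exists 0.
  exact: cvg_lim lim.
Unshelve. all: by end_near. Qed.

Lemma itg_support f (N : R) : continuous f ->
  (forall x, N < `|x| -> f x = 0) -> itg f.
Proof.
move=> cf f0.
have fE : f = f \_ `[- N, N].
  apply/funext => x; rewrite patchE; case: ifPn => //.
  by rewrite notin_setE/= in_itv/= -ler_norml => /negP; rewrite -ltNge; exact: f0.
rewrite /itg fE -restrict_EFin -integrable_mkcond//.
exact: continuous_integrable_itv.
Qed.

Lemma int_support f (N : R) : (forall x, N < `|x| -> f x = 0) ->
  \int[mu]_x f x = \int[mu]_(x in `[- N, N]) f x.
Proof.
move=> f0; rewrite [RHS]Rintegral_mkcond; apply: eq_Rintegral => x _.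
rewrite patchE; case: ifPn => //.
by rewrite notin_setE/= in_itv/= -ler_norml => /negP; rewrite -ltNge; exact: f0.
Qed.

(** Localization formula for the test function [A w], where A is the cube of the positive part of
    the cutoff: the form minus [E <A w, A w>] is the integral of
    [A ^ 2 w (L w - E w) + A' ^ 2 w ^ 2]. *)
Lemma form_ge_cutoff V E w w1 w2 (n : nat) : continuous V -> form_ge V E ->
  has_deriv w w1 -> has_deriv w1 w2 -> continuous w2 ->
  0 <= \int[mu]_(x in `[- n.+1%:R, n.+1%:R])
    ((1 - (n.+1%:R^-1 * x) ^+ 2) ^+ 6 * (w x * (- w2 x + V x * w x - E * w x))
     + 36 * n.+1%:R^-1 ^+ 4 * x ^+ 2 * (1 - (n.+1%:R^-1 * x) ^+ 2) ^+ 4 * w x ^+ 2).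
Proof.
move=> cV fE dw dw1 cw2; set N : R := n.+1%:R; set a := N^-1.
have N0 : 0 < N by rewrite /N.
have NN : - N <= N by lra.
have aN : a * N = 1 by rewrite mulVf// gt_eqF.
have a0 : 0 < a by rewrite invr_gt0.
have cw := has_deriv_continuous _ _ dw; have cw1 := has_deriv_continuous _ _ dw1.
have ds : has_deriv (fun x : R => 1 - (a * x) ^+ 2) (fun x => - 2 * a ^+ 2 * x).
  by apply: has_deriv_eq; [deriv_rule|move=> x /=; ring].
pose M x : R := Num.max 0 (1 - (a * x) ^+ 2).
have MS x : - N <= x <= N -> M x = 1 - (a * x) ^+ 2.
  by move=> /(cutoff_bounds n)/andP[? _]; rewrite /M max_r.
have M0 x : N < `|x| -> M x = 0.
  move=> Nx; rewrite /M max_l// subr_le0 -real_normK ?num_real// expr_ge1//.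
  by rewrite normrM gtr0_norm// /a mulrC ler_pdivlMr// mul1r ltW.
have dA3 := has_deriv_comp _ _ _ _ (has_deriv_max0X 1) ds.
have dA2 := has_deriv_comp _ _ _ _ (has_deriv_max0X 0) ds.
pose A2 x := M x ^+ 2; pose A3 x := M x ^+ 3.
have {}dA3 : has_deriv A3 (fun x => - 6 * a ^+ 2 * x * A2 x).
  by apply: has_deriv_eq; [exact: dA3|move=> x /=; rewrite /A2 /M; ring].
have {}dA2 : has_deriv A2 (fun x => - 4 * a ^+ 2 * x * M x).
  by apply: has_deriv_eq; [exact: dA2|move=> x /=; rewrite /M; ring].
have cM : continuous M.
  have cs := has_deriv_continuous _ _ ds.
  by move=> x; apply: (continuous_comp (cs x)); exact: cont_max0.
have cA2 := has_deriv_continuous _ _ dA2; have cA3 := has_deriv_continuous _ _ dA3.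
pose u x := A3 x * w x.
pose u1 x := - 6 * a ^+ 2 * x * A2 x * w x + A3 x * w1 x.
pose u2 x := - 6 * a ^+ 2 * A2 x * w x + 24 * a ^+ 4 * x ^+ 2 * M x * w x
  - 12 * a ^+ 2 * x * A2 x * w1 x + A3 x * w2 x.
have du : has_deriv u u1.
  by apply: has_deriv_eq; [rewrite /u; deriv_rule|].
have du1 : has_deriv u1 u2.
  by apply: has_deriv_eq; [rewrite /u1; deriv_rule|move=> x /=; rewrite /u2; ring].
have cu : continuous u by rewrite /u; cont_rule.
have cu2 : continuous u2 by rewrite /u2; cont_rule.
have A30 x : N < `|x| -> A3 x = 0 by move=> /M0 Mx; rewrite /A3 Mx expr0n.
have A20 x : N < `|x| -> A2 x = 0 by move=> /M0 Mx; rewrite /A2 Mx expr0n.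
have u0 x : N < `|x| -> u x = 0 by move=> /A30 Ax; rewrite /u Ax mul0r.
have u20 x : N < `|x| -> u2 x = 0.
  by move=> Nx; rewrite /u2 M0// A20// A30//; ring.
have L2u : L2 u by apply: (itg_support _ N) => [|x /u0 ->]; [cont_rule|rewrite expr0n].
have L2u2 : L2 u2 by apply: (itg_support _ N) => [|x /u20 ->]; [cont_rule|rewrite expr0n].
have := fE _ _ _ du du1 cu2 L2u L2u2.
rewrite (int_support _ N) => [|x /u0 ->]; last by rewrite expr0n.
rewrite (int_support _ N) => [|x /u0 ->]; last by rewrite mul0r.
have c1 : continuous (fun x => u x ^+ 2) by cont_rule.
have c2 : continuous (fun x => u x * (- u2 x + V x * u x)) by cont_rule.
rewrite -itv_intZ// -subr_ge0 -itv_intB//; last by cont_rule.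
(* This is [A A' w ^ 2]. Adding its derivative, of integral zero, trades
   [- A A'' w ^ 2 - 2 A A' w w'] for [A' ^ 2 w ^ 2]. *)
pose k x := - 6 * a ^+ 2 * x * (1 - (a * x) ^+ 2) ^+ 5 * w x ^+ 2.
pose k1 x := - 6 * a ^+ 2 * (1 - (a * x) ^+ 2) ^+ 5 * w x ^+ 2
  + 60 * a ^+ 4 * x ^+ 2 * (1 - (a * x) ^+ 2) ^+ 4 * w x ^+ 2
  - 12 * a ^+ 2 * x * (1 - (a * x) ^+ 2) ^+ 5 * w x * w1 x.
have dk : has_deriv k k1.
  by apply: has_deriv_eq; [rewrite /k; deriv_rule|move=> x /=; rewrite /k1; ring].
have ck1 : continuous k1 by rewrite /k1; cont_rule.
have k0 : \int[mu]_(x in `[- N, N]) k1 x = 0.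
  by rewrite (FTC2 _ _ _ _ NN dk ck1) /k !mulrN aN; ring.
move=> h; rewrite -[leRHS]subr0 -[X in _ - X]k0 -itv_intB//; last by cont_rule.
apply: le_trans h _; rewrite le_eqVlt; apply/orP; left; apply/eqP.
apply: eq_Rintegral => x; rewrite inE/= in_itv/= => /MS Mx.
by rewrite /k1 /u /u2 /A2 /A3 Mx; ring.
Qed.

(* A test function of width [N] sees the mean of [q] on a length of order [N],
   while the remaining terms stay bounded. *)
Lemma form_ge_mean (V w w1 w2 F : R -> R) (E T : R) : continuous V -> form_ge V E ->
  0 < T -> has_deriv w w1 -> has_deriv w1 w2 -> continuous w2 ->
  periodic w T -> periodic w2 T -> periodic V T ->
  has_deriv F (fun x => w x * (- w2 x + V x * w x - E * w x)) ->
  forall x, F x <= F (x + T).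
Proof.
move=> cV fE T0 dw dw1 cw2 wT w2T VT dF x0; rewrite leNgt; apply/negP => Fneg.
have cw := has_deriv_continuous _ _ dw.
set q := (fun x => w x * _) in dF.
have cq : continuous q by rewrite /q; cont_rule.
have qT : periodic q T by move=> x; rewrite /q wT w2T VT.
(* The mean of q is [- d], so [P] below is a primitive of its fluctuation [q + d]; being periodic,
   it is bounded. *)
pose d := (F x0 - F (x0 + T)) / T.
have d0 : 0 < d by rewrite divr_gt0// subr_gt0.
pose P x := F x + d * x.
have dP : has_deriv P (fun x => q x + d).
  by apply: has_deriv_eq; [rewrite /P; deriv_rule; exact: dF|move=> x /=; ring].
have PT : periodic P T.
  move=> x; have := primitive_periodic _ _ _ qT dF x x0.
  have : d * T = F x0 - F (x0 + T) by rewrite /d mulrVK// unitfE gt_eqF.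
  rewrite /P mulrDr; lra.
have cP := has_deriv_continuous _ _ dP.
have [C PC] := periodic_bounded _ _ T0 cP PT.
have [W wW] := periodic_bounded _ _ T0 cw wT.
have C0 : 0 <= C by apply: le_trans (PC 0).
have W0 : 0 <= W by apply: le_trans (wW 0).
(* The left side grows linearly in n and the right side is fixed, which is absurd for large n. *)
have bound (n : nat) : d * (3 / 32) * n.+1%:R <= 24 * C + 72 * W ^+ 2.
  have := form_ge_cutoff _ _ _ _ _ n cV fE dw dw1 cw2.
  set N : R := n.+1%:R; set a := N^-1.
  have N0 : 0 < N by rewrite /N.
  have NN : - N <= N by lra.
  have aN : a * N = 1 by rewrite mulVf// gt_eqF.
  have a0 : 0 < a by rewrite invr_gt0.
  have a1 : a <= 1 by rewrite invf_le1// ler1n.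
  (* Integrating by parts replaces [q] by [- d] up to a term with one derivative on the cutoff, of
     size a times the bound of P. *)
  pose k x := (1 - (a * x) ^+ 2) ^+ 6 * P x.
  pose k1 x := (1 - (a * x) ^+ 2) ^+ 6 * (q x + d)
    - 12 * a ^+ 2 * x * (1 - (a * x) ^+ 2) ^+ 5 * P x.
  have dk : has_deriv k k1.
    by apply: has_deriv_eq; [rewrite /k; deriv_rule|move=> x /=; rewrite /k1; ring].
  have ck1 : continuous k1 by rewrite /k1; cont_rule.
  have k0 : \int[mu]_(x in `[- N, N]) k1 x = 0.
    by rewrite (FTC2 _ _ _ _ NN dk ck1) /k !mulrN aN; ring.
  move=> h; rewrite -subr_ge0; apply: le_trans h _.
  rewrite -[leLHS]subr0 -[X in _ - X]k0 -itv_intB//; last by cont_rule.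
  pose B x := 12 * a * C + 36 * a * W ^+ 2 - d * (3 / 16 * (1 - (a * x) ^+ 2) - 5 / 64).
  pose H x := (12 * a * C + 36 * a * W ^+ 2) * x
     - d * (3 / 16 * (x - 3^-1 * a ^+ 2 * x ^+ 3) - 5 / 64 * x).
  have dH : has_deriv H B.
    by apply: has_deriv_eq; [rewrite /H; deriv_rule|move=> x /=; rewrite /B; field].
  have cB : continuous B by rewrite /B; cont_rule.
  have -> : 24 * C + 72 * W ^+ 2 - d * (3 / 32) * N = \int[mu]_(x in `[- N, N]) B x.
    rewrite (FTC2 _ _ _ _ NN dH cB) /H.
    by rewrite /a; field; rewrite gt_eqF.
  apply: itv_int_le => //; first by cont_rule.
  move=> x xN; have /andP[s0 s1] := cutoff_bounds n x xN.
  move: s0 s1; rewrite -/N -/a /k1 /B.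
  have -> : 36 * a ^+ 4 * x ^+ 2 = 36 * a ^+ 2 * (a * x) ^+ 2 by ring.
  have -> : 12 * a ^+ 2 * x = 12 * a * (a * x) by ring.
  have y1 : `|a * x| <= 1.
    rewrite normrM gtr0_norm// /a mulrC ler_pdivrMr// mul1r ler_norml.
    by case/andP: xN => -> ->.
  move: (a * x) y1 => y y1; set s := 1 - y ^+ 2 => s0 s1.
  have y2 : y ^+ 2 <= 1 by move: s0; rewrite /s; lra.
  have A1 : y * s ^+ 5 * P x <= C.
    apply: le_trans (ler_norm _) _; rewrite normrM -[leRHS]mul1r.
    apply: ler_pM => //; rewrite normrM normrX (ger0_norm s0).
    by rewrite mulr_ile1// ?exprn_ge0// exprn_ile1.
  have A2 : y ^+ 2 * s ^+ 4 * w x ^+ 2 <= W ^+ 2.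
    rewrite -[leRHS]mul1r; apply: ler_pM.
    - by rewrite mulr_ge0 ?sqr_ge0// exprn_ge0.
    - exact: sqr_ge0.
    - by apply: mulr_ile1 => //; rewrite ?sqr_ge0 ?exprn_ge0 ?exprn_ile1.
    - by rewrite -(real_normK (num_real (w x))) lerXn2r ?nnegrE.
  (* tangent line of the convex function s ^ 6 at 1 / 2 *)
  have A3 : 3 / 16 * s - 5 / 64 <= s ^+ 6.
    rewrite -subr_ge0.
    have -> : s ^+ 6 - (3 / 16 * s - 5 / 64) =
      (s - 1 / 2) ^+ 2 * (s ^+ 4 + s ^+ 3 + 3 / 4 * s ^+ 2 + s / 2 + 5 / 16) by field.
    apply: mulr_ge0; first exact: sqr_ge0.
    by rewrite !addr_ge0// ?mulr_ge0// ?exprn_ge0.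
  have B1 := ler_wpM2l (mulr_ge0 (ler0n R 12) (ltW a0)) A1.
  have B2 := ler_wpM2l (mulr_ge0 (ler0n R 36) (ltW (mulr_gt0 a0 a0))) A2.
  have B3 := ler_wpM2l (ltW d0) A3.
  have B4 := ler_wpM2r (sqr_ge0 W) (ler_wpM2l (ltW a0) a1).
  rewrite -[q x]/(w x * (- w2 x + V x * w x - E * w x)).
  move: B1 B2 B3 B4; clear; lra.
have [n] : exists n : nat, (24 * C + 72 * W ^+ 2) / (d * (3 / 32)) < n%:R.
  exists (Num.bound ((24 * C + 72 * W ^+ 2) / (d * (3 / 32)))).
  apply: archi_boundP; apply: divr_ge0; last by rewrite mulr_ge0// ltW.
  by rewrite addr_ge0// mulr_ge0// sqr_ge0.
rewrite ltr_pdivrMr; last by rewrite mulr_gt0.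
rewrite ltNge => /negP; apply.
apply: le_trans (bound n); rewrite mulrC ler_wpM2l ?ler_nat//.
by rewrite mulr_ge0// ltW.
Qed.

End TestFunction.

(** * Absence of zeros of the periodic eigenfunction *)

Section GroundState.
Context {R : realType}.
Local Notation mu := (@lebesgue_measure R).
Implicit Types f g : R -> R.

Lemma has_deriv_unique f g1 g2 : has_deriv f g1 -> has_deriv f g2 -> g1 = g2.
Proof. by move=> /has_deriv_derive1 <- /has_deriv_derive1. Qed.

Lemma has_deriv_periodic T f g : periodic f T -> has_deriv f g -> periodic g T.
Proof.
move=> fT df x.
have dT : has_deriv (fun x : R => x + T) (fun=> 1).
  by apply: has_deriv_eq; [deriv_rule|move=> y /=; rewrite addr0].
have := has_deriv_comp _ _ _ _ df dT.
rewrite (_ : (fun y => f (y + T)) = f); last by apply/funext.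
by move=> /has_deriv_unique/(_ df)/(congr1 (@^~ x)) <-; rewrite mulr1.
Qed.

Lemma has_deriv_ge0 f g a b : has_deriv f g -> (forall x, 0 <= g x) -> a <= b ->
  f a <= f b.
Proof.
move=> df g0; rewrite le_eqVlt => /predU1P[->//|ab].
have [c _ fE] := MVT_has_deriv _ _ _ _ ab df.
by rewrite -subr_ge0 fE mulr_ge0// subr_ge0 ltW.
Qed.

(* The regularization [sqrt (psi ^ 2 + e)] of [|psi|] has an energy density whose
   mean tends to [-oo] as [e] tends to 0 as soon as [psi] has a zero. *)
Lemma ground_state_neq0 (V psi psi1 psi2 : R -> R) (E T : R) : 0 < T ->
  continuous V -> periodic V T -> form_ge V E ->
  has_deriv psi psi1 -> has_deriv psi1 psi2 -> periodic psi T ->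
  (forall x, psi2 x = V x * psi x - E * psi x) ->
  (exists x, psi x != 0) -> forall x, psi x != 0.
Proof.
move=> T0 cV VT fE d0 d1 psiT psiE [x' px'] x0; apply/negP => /eqP px0.
have [y yT py] : exists2 y, 0 <= y <= T & psi (x0 + y) != 0.
  have [y yT yE] := periodic_reduce T (x' - x0) T0; exists y => //.
  rewrite -(yE (fun z => psi (x0 + z))); first by rewrite addrC subrK.
  by move=> z; rewrite addrA psiT.
have c0 := has_deriv_continuous _ _ d0; have c1 := has_deriv_continuous _ _ d1.
have c2 : continuous psi2.
  by rewrite (funext psiE); cont_rule.
have [U dU] : exists U, has_deriv U (fun x => V x - E).
  by apply: primitive_exists; cont_rule.
pose m := U (x0 + T) - U x0.
(* The mean inequality will force [ln (psi (x0 + y) ^+ 2) - ln e <= m + T]; this [e] makes the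
   difference [m + T + 1]. *)
pose e : R := expR (ln (psi (x0 + y) ^+ 2) - m - T - 1).
have e0 : 0 < e by exact: expR_gt0.
pose g x := psi x ^+ 2 + e.
have g0 x : 0 < g x by rewrite /g ltr_wpDl// sqr_ge0.
have gn0 x : g x != 0 by rewrite gt_eqF.
have dg : has_deriv g (fun x => 2 * psi x * psi1 x).
  by apply: has_deriv_eq; [rewrite /g; deriv_rule|move=> x /=; ring].
have cg := has_deriv_continuous _ _ dg.
pose w x := Num.sqrt (g x).
have w0 x : w x != 0 by rewrite gt_eqF// sqrtr_gt0.
have wg x : w x ^+ 2 = g x by rewrite sqr_sqrtr// ltW.
pose w1 x := psi x * psi1 x * (w x)^-1.
have dw : has_deriv w w1.
  move=> x; have := is_derive1_comp (is_derive1_sqrt (g0 x)) (dg x).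
  have <- : (2 * w x)^-1 * (2 * psi x * psi1 x) = w1 x by rewrite /w1; field.
  by [].
have dV := has_derivV _ _ w0 dw.
pose w2 x := (psi1 x ^+ 2 + psi x * psi2 x) * (w x)^-1
  - psi x * psi1 x * (w1 x / w x ^+ 2).
have dw1 : has_deriv w1 w2.
  apply: has_deriv_eq; first by rewrite /w1; deriv_rule; exact: dV.
  by move=> x /=; rewrite /w2 /w1; field.
have cw := has_deriv_continuous _ _ dw; have cw1 := has_deriv_continuous _ _ dw1.
have cwV := has_deriv_continuous _ _ dV.
have cwV2 : continuous (fun x => (w x ^+ 2)^-1).
  by apply: contV => [x|]; [rewrite expf_neq0|cont_rule].
have cw2 : continuous w2 by rewrite /w2; cont_rule.
have wT : periodic w T by move=> x; rewrite /w /g psiT.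
have w2T : periodic w2 T.
  exact: (has_deriv_periodic _ _ _ (has_deriv_periodic _ _ _ wT dw) dw1).
have cgV := contV _ gn0 cg.
have [Z dZ] : exists Z, has_deriv Z (fun x => psi1 x ^+ 2 / g x).
  by apply: primitive_exists; cont_rule.
(* The energy density of w reduces to [e (V - E - psi1 ^ 2 / g)], since [psi] solves the eigenvalue
   equation. So the mean inequality bounds the growth of Z over a period by m. *)
have dF : has_deriv (fun x => e * (U x - Z x))
    (fun x => w x * (- w2 x + V x * w x - E * w x)).
  apply: has_deriv_eq; first by deriv_rule.
  move=> x /=; rewrite /w2 /w1 psiE.
  have -> : g x = w x ^+ 2 by [].
  have eE : e = w x ^+ 2 - psi x ^+ 2 by rewrite wg /g addrC addKr.
  by rewrite eE; field.
have := form_ge_mean _ _ _ _ _ _ _ cV fE T0 dw dw1 cw2 wT w2T VT dF x0.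
rewrite ler_pM2l// => UZ.
have dL : has_deriv (fun x => ln (g x)) (fun x => (g x)^-1 * (2 * psi x * psi1 x)).
  by move=> x; exact: (is_derive1_comp (is_derive1_ln (g0 x)) (dg x)).
(* Completing the square: a rise of [ln g] from its value [ln e] at the zero forces Z to rise as
   well, up to the length travelled. *)
have dD : has_deriv (fun x => Z x - ln (g x) + x)
    (fun x => (psi1 x - psi x) ^+ 2 / g x + e / g x).
  apply: has_deriv_eq; first by deriv_rule.
  by move=> x /=; have := gn0 x; rewrite /g => gn; field.
have /andP[y0 yT'] := yT.
have : Z x0 - ln (g x0) + x0 <= Z (x0 + y) - ln (g (x0 + y)) + (x0 + y).
  apply: has_deriv_ge0 dD _ _; last by rewrite lerDl.
  by move=> x; rewrite addr_ge0// divr_ge0 ?sqr_ge0// ltW.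
have : Z (x0 + y) <= Z (x0 + T).
  apply: has_deriv_ge0 dZ _ _; last by rewrite lerD2l.
  by move=> x; rewrite divr_ge0 ?sqr_ge0// ltW.
have -> : ln (g x0) = ln (psi (x0 + y) ^+ 2) - m - T - 1.
  by rewrite /g px0 expr0n add0r expRK.
have : ln (psi (x0 + y) ^+ 2) <= ln (g (x0 + y)).
  by rewrite ler_ln ?posrE// ?exprn_even_gt0// /g lerDl ltW.
move: UZ; rewrite /m; lra.
Qed.

End GroundState.

(** * Signs of the coefficients *)

Section Coefficients.
Context {R : realType}.
Local Notation mu := (@lebesgue_measure R).
Local Notation T := (2 * pi : R).

Lemma intper_has_deriv (H h : R -> R) : has_deriv H h -> continuous h ->
  periodic H T -> intper h = 0.
Proof.
move=> dH ch HT; have T0 : 0 <= T by rewrite mulr_ge0// pi_ge0.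
by rewrite /intper (FTC2 _ _ _ _ T0 dH ch) -{1}(add0r T) HT subrr.
Qed.

Lemma solves_has_deriv (V : R -> R) E (f u : R -> R) : solves V E f u ->
  has_deriv u (derive1 u) /\
  has_deriv (derive1 u) (fun x => V x * u x - E * u x - f x).
Proof.
move=> [du du1 uE]; split; first exact: derivable_has_deriv.
apply: has_deriv_eq; first exact: derivable_has_deriv.
by move=> x; rewrite -uE /=; ring.
Qed.

End Coefficients.

Theorem mainTheorem6 (R : realType) (V G : R -> R)
  (V_smooth : smooth V) (G_smooth : smooth G)
  (V_periodic : periodic V (2 * pi)) (G_periodic : periodic G (2 * pi))
  (V_even : forall x, V (- x) = V x) (G_odd : forall x, G (- x) = - G x)
  (G_nonzero : exists x, G x <> 0)
  (E0 : R) (E0_bottom : spectrum_bottom V E0)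
  (Psi0 Psi1 Psi2 : R -> R)
  (Psi0_periodic : periodic Psi0 (2 * pi))
  (Psi0_eigen : solves V E0 (fun=> 0) Psi0)
  (Psi0_normalized : intper (fun x => Psi0 x ^+ 2) = 1)
  (Psi1_periodic : periodic Psi1 (2 * pi))
  (Psi1_odd : forall x, Psi1 (- x) = - Psi1 x)
  (Psi1_orth : intper (fun x => Psi1 x * Psi0 x) = 0)
  (Psi1_eq : solves V E0 (fun x => 2 * derive1 Psi0 x) Psi1)
  (Psi2_periodic : periodic Psi2 (2 * pi))
  (Psi2_odd : forall x, Psi2 (- x) = - Psi2 x)
  (Psi2_orth : intper (fun x => Psi2 x * Psi0 x) = 0)
  (Psi2_eq : solves V E0 (fun x => - (G x * Psi0 x ^+ 3)) Psi2) :
  let alpha := coef_alpha Psi0 Psi1 in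
  let chi := coef_chi G Psi0 Psi2 in
  let gamma := coef_gamma G Psi0 Psi1 Psi2 in
  [/\ gamma = 0, alpha < 0, chi < 0,
      forall (A : R -> R -> complex R) (X T : R),
        cnls alpha chi gamma A X T <-> quintic_nls alpha chi A X T &
      focusing alpha chi].
Proof.
move=> alpha chi gamma; set T := 2 * pi in V_periodic *.
have T0 : 0 < T by rewrite mulr_gt0// pi_gt0.
have TT : 0 <= T by exact: ltW.
have cV : continuous V := has_deriv_continuous _ _ (derivable_has_deriv _ (V_smooth 0)).
have cG : continuous G := has_deriv_continuous _ _ (derivable_has_deriv _ (G_smooth 0)).
have [dp dp1] := solves_has_deriv _ _ _ _ Psi0_eigen.
have [dr dr1] := solves_has_deriv _ _ _ _ Psi1_eq.
have [dt dt1] := solves_has_deriv _ _ _ _ Psi2_eq.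
move: dp dp1 dr dr1 dt dt1; rewrite /alpha /chi /gamma /coef_alpha /coef_chi /coef_gamma.
set p := Psi0; set p1 := derive1 p; set r := Psi1; set r1 := derive1 r.
set t := Psi2; set t1 := derive1 t => dp dp1 dr dr1 dt dt1.
have cp := has_deriv_continuous _ _ dp; have cp1 := has_deriv_continuous _ _ dp1.
have cr := has_deriv_continuous _ _ dr; have cr1 := has_deriv_continuous _ _ dr1.
have ct := has_deriv_continuous _ _ dt; have ct1 := has_deriv_continuous _ _ dt1.
have p1T := has_deriv_periodic _ _ _ Psi0_periodic dp.
have r1T := has_deriv_periodic _ _ _ Psi1_periodic dr.
have t1T := has_deriv_periodic _ _ _ Psi2_periodic dt.
have pT : periodic p T := Psi0_periodic.
have rT : periodic r T := Psi1_periodic.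
have tT : periodic t T := Psi2_periodic.
have [M VM] := periodic_bounded _ _ T0 cV V_periodic.
have p0 : forall x, p x != 0.
  apply: (ground_state_neq0 _ _ _ _ _ _ T0 cV V_periodic
    (spectrum_bottom_form_ge _ _ _ cV VM E0_bottom) dp dp1 Psi0_periodic).
    by move=> x; rewrite subr0.
  apply: contrapT => np; have pz x : p x = 0.
    by apply/eqP/negPn/negP => px; apply: np; exists x.
  move: Psi0_normalized; rewrite /intper.
  under eq_Rintegral do rewrite -/p pz expr0n/=.
  by rewrite itv_int_cst// mul0r => /esym/eqP; rewrite oner_eq0.
have cpV := contV _ p0 cp; have dpV := has_derivV _ _ p0 dp.
have gamma0 : - 2 * intper (fun x => t1 x * p x)
    + intper (fun x => G x * p x ^+ 3 * r x) = 0.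
  have c1 : continuous (fun x => t1 x * p x) by cont_rule.
  have c2 : continuous (fun x => G x * p x ^+ 3 * r x) by cont_rule.
  rewrite /intper -itv_intZ// -itv_intD//; last by cont_rule.
  (* The Wronskian of t and r leaves [G p ^ 3 r + 2 t p1]; the last term of the primitive turns
     [2 t p1] into [- 2 t1 p]. *)
  apply: (intper_has_deriv (fun x => t1 x * r x - t x * r1 x - 2 * (t x * p x))).
  - by apply: has_deriv_eq; [deriv_rule|move=> x /=; ring].
  - by cont_rule.
  - by move=> x; rewrite t1T r1T pT rT tT.
have alpha_lt0 : - 1 - 2 * intper (fun x => r1 x * p x) < 0.
  pose W x := r1 x * p x - r x * p1 x + p x ^+ 2.
  have dW : has_deriv W (fun=> 0).
    by apply: has_deriv_eq; [rewrite /W; deriv_rule|move=> x /=; ring].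
  have WE x : r1 x * p x - r x * p1 x = W 0 - p x ^+ 2.
    by rewrite -(has_deriv0_cst _ dW x 0) /W; ring.
  (* The periodic quotient [r / p] has a critical point c by the mean value theorem, and its
     derivative is [(W 0 - p ^ 2) / p ^ 2]. *)
  have [c] : exists c, W 0 = p c ^+ 2.
    have dq : has_deriv (fun x => r x * (p x)^-1)
        (fun x => (r1 x * p x - r x * p1 x) / p x ^+ 2).
      by apply: has_deriv_eq; [deriv_rule; exact: dpV|move=> x /=; field].
    have [c _] := MVT_has_deriv _ _ _ _ T0 dq.
    have -> : p T = p 0 by rewrite -(pT 0) add0r.
    have -> : r T = r 0 by rewrite -(rT 0) add0r.
    rewrite subrr WE subr0 => /esym/eqP.
    rewrite mulf_eq0 (gt_eqF T0) orbF mulf_eq0 invr_eq0 expf_eq0 (negPf (p0 c)) andbF orbF.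
    by rewrite subr_eq0 => /eqP; exists c.
  move=> Wc; have W0 : 0 < W 0 by rewrite Wc exprn_even_gt0// p0.
  have c1 : continuous (fun x => r1 x * p x) by cont_rule.
  have c2 : continuous (fun x => p x ^+ 2) by cont_rule.
  have c3 : continuous (fun _ : R => W 0) by exact: contC.
  (* With the normalization of p this reads [alpha = - T * W 0]. *)
  have : intper (fun x => 2 * (r1 x * p x) + p x ^+ 2 - W 0) = 0.
    apply: (intper_has_deriv (fun x => r x * p x)).
    - apply: has_deriv_eq; [deriv_rule|move=> x /=].
      by have := WE x; lra.
    - by cont_rule.
    - by move=> x; rewrite pT rT.
  rewrite /intper itv_intB//; last by cont_rule.
  rewrite itv_intD//; last by cont_rule.
  rewrite itv_intZ// itv_int_cst// -/T subr0.
  move: Psi0_normalized; rewrite /intper -/T -/p => ->.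
  by have := mulr_gt0 W0 T0; lra.
have chi_lt0 : 3 * intper (fun x => G x * p x ^+ 3 * t x) < 0.
  pose h x := t1 x - t x * p1 x * (p x)^-1.
  have ch : continuous h by rewrite /h; cont_rule.
  have ch2 : continuous (fun x => h x ^+ 2) by cont_rule.
  have cGt : continuous (fun x => G x * p x ^+ 3 * t x) by cont_rule.
  have hT : periodic h T.
    by move=> x; rewrite /h t1T p1T pT tT.
  have h2T : periodic (fun x => h x ^+ 2) T by move=> x; rewrite hT.
  have [K dK] := primitive_exists _ ch2.
  have : intper (fun x => h x ^+ 2 + G x * p x ^+ 3 * t x) = 0.
    (* The primitive is [t h]; as [p1 / p] solves the Riccati equation,
       [h' = G p ^ 3 - h p1 / p]. *)
    apply: (intper_has_deriv (fun x => t x * t1 x - t x ^+ 2 * p1 x * (p x)^-1)).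
    - apply: has_deriv_eq; [deriv_rule; exact: dpV|move=> x /=].
      by rewrite /h; field.
    - by cont_rule.
    - by move=> x; rewrite t1T p1T pT tT.
  rewrite /intper itv_intD// (FTC2 _ _ _ _ TT dK ch2).
  suff : K 0 < K T by lra.
  have Kle a b : a <= b -> K a <= K b.
    by apply: has_deriv_ge0 dK _ => x; exact: sqr_ge0.
  (* In case of equality the monotone function K is periodic, hence constant, so [h = 0] and [t / p]
     is constant. Then t solves the homogeneous equation too, which forces [G p ^ 3 = 0]. *)
  rewrite lt_neqAle Kle// andbT; apply/eqP => KT.
  have Kper : periodic K T.
    move=> x; have := primitive_periodic _ _ _ h2T dK x 0.
    by rewrite add0r -KT subrr => /eqP; rewrite subr_eq0 => /eqP.
  have Kcst x : K x = K 0.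
    have [y /andP[y0 yT] /(_ _ Kper) ->] := periodic_reduce T x T0.
    by apply/le_anti; rewrite [K 0 <= _]Kle// andbT KT Kle.
  have h0 x : h x = 0.
    have dK0 : has_deriv K (fun=> 0).
      by rewrite (funext Kcst); exact: has_deriv_cst.
    have /(congr1 (@^~ x))/eqP := has_deriv_unique _ _ _ dK dK0.
    by rewrite expf_eq0/= => /eqP.
  have dk : has_deriv (fun x => t x * (p x)^-1) (fun=> 0).
    apply: has_deriv_eq; [deriv_rule; exact: dpV|move=> x /=].
    have -> : t1 x = t x * p1 x * (p x)^-1 by apply/eqP; rewrite -subr_eq0; apply/eqP/h0.
    by field.
  pose k := t 0 * (p 0)^-1.
  have tE : t = fun x => k * p x.
    by apply/funext => x; rewrite /k -(has_deriv0_cst _ dk x 0) mulfVK.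
  have t1E : t1 = fun x => k * p1 x.
    apply: has_deriv_unique dt _; rewrite tE.
    by apply: has_deriv_eq; [deriv_rule|move=> x /=; ring].
  have [x Gx] := G_nonzero; apply: Gx.
  have dt1' : has_deriv t1 (fun x => k * (V x * p x - E0 * p x - 0)).
    by rewrite t1E; apply: has_deriv_eq; [deriv_rule|move=> y /=; ring].
  have /(congr1 (@^~ x)) := has_deriv_unique _ _ _ dt1 dt1'.
  rewrite tE => Gp; have : G x * p x ^+ 3 = 0 by move: Gp => /=; lra.
  by move/eqP; rewrite mulf_eq0 expf_eq0/= (negPf (p0 x)) orbF => /eqP.
split => //; last by rewrite /focusing nmulr_rgt0.
by move=> A X S; rewrite /cnls /quintic_nls gamma0 mul0r addr0.
Qed.
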